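(* Let $X$ be a Polish space with Borel probability measure $\mu$, let $d\ge 1$, and let $G$ be a $d$-regular bipartite Borel graph on $X$ that admits a connected toast. Then $G$ admits a Borel perfect matching a.e., i.e. there is a $G$-invariant $\mu$-conull Borel set $X'\subseteq X$ such that $G|_{X'}$ has a Borel perfect matching.
   Context: A Borel graph $G$ on a Polish space $X$ is a (simple, undirected) graph with vertex set $X$ whose edge set is a Borel subset of $X^2$. Bipartite is meant in the usual graph-theoretic sense (no odd cycles); no Borel bipartition is assumed, and no invariance of $\mu$ is assumed. A set is $G$-invariant if it is a union of connected components of $G$; $G|_{X'}$ is the induced subgraph. A Borel perfect matching is a Borel set of edges such that every vertex lies in exactly one edge of the set. Toasts. $X^{<\omega}$ is the (standard Borel) space of finite subsets of $X$. For $K\subseteq X$, $E(K)$ is the set of edges of the subgraph induced on $K$, and $B_1(K)$ is the set of vertices at graph distance at most $1$ from $K$. A Borel collection $\mathcal{T}\subset X^{<\omega}$ is a toast for $G$ if (T1) $\bigcup_{K\in\mathcal{T}}E(K)=E(G)$, and (T2) for every pair of distinct $K,L\in\mathcal{T}$, either $B_1(K)\cap L=\emptyset$, or $B_1(K)\subseteq L$, or $B_1(L)\subseteq K$. It is connected if (T3) for every $K\in\mathcal{T}$ the induced subgraph on $K\setminus\bigcup_{K\supsetneq L\in\mathcal{T}}L$ is connected. $G$ admits a connected toast if such a $\mathcal{T}$ exists. *)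

(* Defs.v *)
From HB Require Import structures.
From mathcomp Require Import all_boot all_order all_algebra.
From mathcomp Require Import all_classical all_reals all_analysis.

Set Implicit Arguments.
Unset Strict Implicit.
Unset Printing Implicit Defensive.

Import Order.TTheory GRing.Theory Num.Theory.
Local Open Scope classical_set_scope.
Local Open Scope card_scope.

Section Polish.
Variable R : realType.

Definition separable (T : topologicalType) : Prop :=
  exists2 D : set T, countable D & dense D.

Definition completely_metrizable (T : topologicalType) : Prop :=
  exists (M : metricType R) (f : T -> M) (g : M -> T),
    [/\ cancel f g, cancel g f, continuous f, continuous g &
        forall F : set_system M, ProperFilter F -> cauchy F ->
          exists l : M, F --> l].

Definition polish (T : topologicalType) : Prop :=
  separable T /\ completely_metrizable T.

End Polish.

Notation borel T := (g_sigma_algebraType (@open T)).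

Definition borel_set (T : topologicalType) (A : set T) : Prop :=
  <<s @open T >> A.

Section Graphs.
Variable X : topologicalType.
Implicit Types (G M : set (X * X)) (A K L : set X) (T : set (set X)).

(* An undirected edge set is a symmetric subset of X * X: the edge {x, y} is
   represented by both (x, y) and (y, x). *)

Definition simple_graph G : Prop :=
  (forall x, ~ G (x, x)) /\ (forall x y, G (x, y) -> G (y, x)).

Definition borel_graph G : Prop := simple_graph G /\ borel_set G.

Definition adj G : rel X := fun x y => `[< G (x, y) >].

Definition regular d G : Prop := forall x, [set y | G (x, y)] #= `I_d.

Definition is_cycle G (c : seq X) : Prop := (2 < size c)%N /\ ucycle (adj G) c.

Definition bipartite G : Prop := forall c, is_cycle G c -> ~~ odd (size c).

(* E(A), which is also the edge set of the induced subgraph on A. *)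
Definition induced G A : set (X * X) := G `&` (A `*` A).

Definition reachable G x y : Prop :=
  exists2 p : seq X, path (adj G) x p & last x p = y.

Definition component G x : set X := [set y | reachable G x y].

(* The empty set counts as connected. *)
Definition connected_on G A : Prop :=
  forall x y, A x -> A y -> reachable (induced G A) x y.

Definition graph_invariant G A : Prop :=
  exists S : set X, A = \bigcup_(x in S) component G x.

Definition B1 G K : set X := [set y | exists2 x, K x & x = y \/ G (x, y)].

(* The Borel structure on the space of finite subsets of X is the quotient of
   that of the disjoint union of the X^n under (x_i)_(i < n) |-> {x_i | i < n};
   tuples with repetitions are allowed, which yields the same structure. *)
Definition borel_finite_sets T : Prop :=
  T `<=` finite_set /\
  forall n, borel_set [set x : {ptws 'I_n -> X} | T (range x)].

Definition toast G T : Prop :=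
  [/\ borel_finite_sets T,
      \bigcup_(K in T) induced G K = G &
      forall K L, T K -> T L -> K <> L ->
        [\/ B1 G K `&` L = set0, B1 G K `<=` L | B1 G L `<=` K]].

Definition connected_toast G T : Prop :=
  toast G T /\
  forall K, T K ->
    connected_on G (K `\` \bigcup_(L in [set L | T L /\ L `<` K]) L).

Definition borel_perfect_matching G A M : Prop :=
  [/\ borel_set M, M `<=` induced G A,
      forall x y, M (x, y) -> M (y, x) &
      forall x, A x -> exists! y, M (x, y)].

End Graphs.

(* Main.v *)
Require Import Defs.
From HB Require Import structures.
From mathcomp Require Import all_boot all_order all_algebra.
From mathcomp Require Import all_classical all_reals all_analysis.
From mathcomp Require Import measurable_realfun.
From mathcomp Require Import zify ring lra.

Set Implicit Arguments.
Unset Strict Implicit.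
Unset Printing Implicit Defensive.

Import Order.TTheory GRing.Theory Num.Theory.

(* Work with fractional perfect matchings all of whose values lie in (1/d)Z,
   starting from the constant 1/d (and from an honest perfect matching on the
   finite components). At stage k treat the pairwise disjoint sets K of the toast
   with k elements: choose an even-degree subgraph of the graph of non-integral
   edges in E(K) and, as G is bipartite, shift the values by +-1/d alternately
   along its Eulerian circuits. For L strictly inside K, a non-integral edge in
   E(L) is not a bridge of this graph: one side of a bridge would avoid the
   connected set K \ U{L : L < K}, all of whose edges still have value 1/d, so all
   its edges would lie in E(K) and counting them around that side would make the
   bridge integral. Hence a random even subgraph changes each such edge with
   probability 1/2. Averaging over finitely many seeds, one fixed choice at each
   stage increases the energy (the integral of the sum of the squared values) by at
   least a fixed multiple of the measure of the vertices on such edges. The energy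
   is bounded, so by Borel-Cantelli almost every edge becomes integral after
   finitely many stages. As mu need not be quasi-invariant, the energy is summed
   over all walks with geometrically decreasing weights, so that almost every
   point has its whole component resolved.

   Borelness: every object constructed is a map into a countable set with analytic
   level sets, which is Borel by Suslin's theorem. *)

(** * Even subgraphs of finite graphs and their alternating signings *)

(** Independent random choices in the pieces of a stage would themselves have to be measurable.
    Instead one seed from a finite set is used in all pieces of size [k] at once, each piece being
    identified with ['I_k] by its increasing enumeration for a fixed Borel order; averaging only
    uses expectations, so no independence between pieces is needed. A seed is an arbitrary edge set,
    rounded to an even subgraph, together with a global sign. The sign cancels the linear term of
    the change of energy and leaves the squares of the shifts. Values move by one unit and only when
    strictly between 0 and [d], so they stay in the interval and integral ones are frozen. In an
    infinite component every toast set lies strictly inside larger ones, so each edge is tested at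
    infinitely many stages; in a finite component the toast may stop, hence the separate start
    there. The bipartition is obtained by choice and may fail to be Borel, but it only serves to
    prove that signings exist. The weight [(2d)^-n] beats the [d^n] walks of length [n]. *)

Section EvenSubgraphs.
Local Open Scope ring_scope.

Section Signing.
Variable V : finType.
Implicit Types (A : {set V}) (z : {ffun V * V -> bool}).

(** Used to pair up the edges at each vertex of an even subgraph, which splits the subgraph into
    closed trails. *)
Lemma fixpoint_free_involution A : ~~ odd #|A| ->
  exists t : V -> V, [/\ involutive t, {in A, forall x, t x \in A},
    {in A, forall x, t x != x} & forall x, x \notin A -> t x = x].
Proof.
have [n] := ubnP #|A|; elim: n A => // n IHn A ltAn evA.
have [->|[a aA]] := set_0Vmem A.
  by exists id; split=> // x; rewrite inE.
have cA1 : #|A| = (#|A :\ a|).+1 by rewrite (cardsD1 a) aA.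
have [A1|[b bA]] := set_0Vmem (A :\ a).
  by move: evA; rewrite cA1 A1 cards0.
have cA2 : #|A :\ a| = (#|A :\ a :\ b|).+1 by rewrite (cardsD1 b) bA.
have /andP[ba bA'] : (b != a) && (b \in A) by move: bA; rewrite !inE.
have [||t [tt tA tn tid]] := IHn (A :\ a :\ b).
- by rewrite cA1 cA2 in ltAn; lia.
- by move: evA; rewrite cA1 cA2 /= negbK.
have ta : t a = a by apply: tid; rewrite !inE eqxx andbF.
have tb : t b = b by apply: tid; rewrite !inE eqxx.
have tab x : (t x == a) = (x == a) /\ (t x == b) = (x == b).
  by split; apply/eqP/eqP=> [h|->//]; rewrite -[x]tt h.
exists (fun x => if x == a then b else if x == b then a else t x); split=> x.
- have [ea eb] := tab x; case: (eqVneq x a) => [->|xa].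
    by rewrite (negPf ba) eqxx.
  case: (eqVneq x b) => [->|xb]; first by rewrite eqxx.
  by rewrite ea eb (negPf xa) (negPf xb) tt.
- move=> xA; case: (eqVneq x a) => // xa; case: (eqVneq x b) => // xb.
  by have := tA x; rewrite !inE xa xb xA => /(_ isT) /and3P[].
- move=> xA; case: (eqVneq x a) => [->//|xa]; case: (eqVneq x b) => [->|xb].
    by rewrite eq_sym.
  by apply: tn; rewrite !inE xa xb.
- move=> xA; have xa : x != a by apply: contraNneq xA => ->.
  have xb : x != b by apply: contraNneq xA => ->.
  by rewrite (negPf xa) (negPf xb); apply: tid; rewrite !inE (negPf xA) !andbF.
Qed.

(* The orbits of [al \o si] come in pairs exchanged by both involutions. *)
Lemma two_involutions_alternate (D : {pred V}) (al si : V -> V) :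
    involutive al -> involutive si ->
    {in D, forall h, [/\ al h \in D, si h \in D, al h != h & si h != h]} ->
  exists s : V -> bool,
    {in D, forall h, s (al h) = ~~ s h /\ s (si h) = ~~ s h}.
Proof.
move=> alK siK clD; pose p := al \o si.
have pI : injective p by apply: inj_comp; apply: inv_inj.
have psym := fconnect_sym pI.
have pD h j : h \in D -> iter j p h \in D.
  move=> hD; elim: j => //= j IHj.
  by have [_ sD _ _] := clD _ IHj; have [] := clD _ sD.
have palp j h : iter j p (al (iter j p h)) = al h.
  elim: j h => // j IHj h; rewrite iterSr iterS -[RHS]IHj.
  by congr (iter j p _); rewrite /p /= !alK siK.
(* If [al h] were reached from [h] by [k] steps of [p], the point halfway would be fixed by [al]
   ([k] even) or by [si] ([k] odd). *)
have nal h : h \in D -> ~~ fconnect p h (al h).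
  move=> hD; apply/negP => /iter_findex; set k := findex _ _ _.
  have it_inj j : injective (iter j p).
    by elim: j => //= j IHj x y /pI/IHj.
  have [_ _ xa xs] := clD _ (pD h k./2 hD); move=> kE.
  have := palp k./2 h; rewrite -kE -{3}[k]odd_double_half -addnn.
  case: (odd k).
    rewrite (_ : (true + _ = k./2 + k./2.+1)%N); last by lia.
    rewrite iterD iterS => /it_inj; rewrite /p /= => /(inv_inj alK) h1.
    by rewrite -h1 eqxx in xs.
  by rewrite add0n iterD => /it_inj h1; rewrite h1 eqxx in xa.
(* The orbits of [h] and [al h] differ, so comparing the ranks of their roots tells them apart; the
   answer is constant along [p]. *)
pose s h := (enum_rank (froot p h) < enum_rank (froot p (al h)))%N.
have sal h : h \in D -> s (al h) = ~~ s h.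
  move=> hD; rewrite /s alK -leqNgt [RHS]leq_eqVlt.
  rewrite (inj_eq (@ord_inj _)) (inj_eq enum_rank_inj).
  by rewrite (root_connect psym) psym (negPf (nal h hD)).
have sp h : s (p h) = s h.
  have r1 : froot p (p h) = froot p h.
    by apply/eqP; rewrite (root_connect psym) psym fconnect1.
  have r2 : froot p (al (p h)) = froot p (al h).
    apply/eqP; rewrite (root_connect psym).
    have -> : al h = p (al (p h)) by rewrite /p /= !alK siK.
    exact: fconnect1.
  by rewrite /s r1 r2.
exists s => h hD; split; first exact: sal.
by rewrite -(sp h) /p /= sal ?negbK //; have [] := clD _ hD.
Qed.

End Signing.

(** * Random perturbations of a fractional matching *)

Section Perturbation.
Variable V : finType.
Implicit Types (H : rel V) (z s : {ffun V * V -> bool}) (N : {ffun V * V -> int}).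

Definition signing z (g : V -> V -> int) : Prop :=
  [/\ forall i j, g i j = g j i, forall i j, `|g i j|%N = z (i, j) &
      forall i, \sum_j g i j = 0].

(** Sums of booleans are taken in the field with two elements, so a zero sum at a vertex says that
    its degree is even. *)
Lemma sum_boolE (T : finType) (b : T -> bool) :
  \sum_j b j = odd #|[set j | b j]| :> bool.
Proof.
rewrite -sum1_card (big_morph odd (id1 := false) (op1 := addb)) //; last first.
  by move=> x y; rewrite oddD.
rewrite [RHS]big_mkcond /=; apply: eq_bigr => j _.
by rewrite inE; case: (b j).
Qed.

(** On directed edges [(i, j)], [al] reverses the edge and [si] passes to its partner at the same
    source; a map [s] alternating under both alternates along the closed trails. *)
Lemma signing_exists z (c : V -> bool) :
    (forall i j, z (i, j) = z (j, i)) -> (forall i, \sum_j z (i, j) = 0) ->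
    (forall i j, z (i, j) -> c i != c j) ->
  exists g, signing z g.
Proof.
move=> zC z0 zc.
have /all_sig [t tP] (i : V) : {t : V -> V | [/\ involutive t,
    {in [set j | z (i, j)], forall x, t x \in [set j | z (i, j)]},
    {in [set j | z (i, j)], forall x, t x != x}
    & forall x, x \notin [set j | z (i, j)] -> t x = x]}.
  by apply/cid/fixpoint_free_involution; rewrite -sum_boolE z0.
pose al (h : V * V) := (h.2, h.1).
pose si (h : V * V) := (h.1, t h.1 h.2).
have alK : involutive al by case.
have siK : involutive si by case=> i j; rewrite /si /=; have [-> ] := tP i.
have ztE i j : z (i, t i j) = z (i, j).
  have [ti tz _ _] := tP i; apply/idP/idP => h; last first.
    by have := tz j; rewrite !inE; apply.
  by have := tz (t i j); rewrite !inE ti; apply.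
have [|s sP] := @two_involutions_alternate _ [pred h | z h] al si alK siK.
  move=> [i j]; rewrite inE => zij; split=> //.
  - by rewrite inE zC.
  - by rewrite inE ztE.
  - by apply/eqP => -[ij _]; have := zc _ _ zij; rewrite ij eqxx.
  - have [_ _ tn _] := tP i; apply/eqP => -[tij].
    by have := tn j; rewrite inE tij eqxx => /(_ zij).
(* Reversing an edge flips both [s] and the colour of the source, so the sign is symmetric, while
   partners at [i] still get opposite signs. *)
pose g i j : int := if z (i, j) then (if s (i, j) (+) c i then 1 else -1) else 0.
exists g; split=> i.
- move=> j; rewrite /g zC; case: ifP => // zji.
  have [sji _] := sP (j, i) zji; rewrite /al /= in sji.
  by rewrite sji; have := zc _ _ zji; case: (s _); case: (c i); case: (c j).
- by move=> j; rewrite /g; case: ifP => // _; case: ifP.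
have [ti _ _ _] := tP i.
have gt j : g i (t i j) = - g i j.
  rewrite /g ztE; case: ifP => [zij|]; last by rewrite oppr0.
  have [_ sij] := sP (i, j) zij; rewrite /si /= in sij.
  by rewrite sij; case: (s _); case: (c i) => /=; rewrite ?opprK.
have : \sum_j g i j = - \sum_j g i j.
  rewrite {1}(reindex_inj (inv_inj ti)) -sumrN.
  by apply: eq_bigr => j _; rewrite gt.
by lia.
Qed.

(** The cycle space of [H] over the two-element field. *)
Definition even_subgraphs (H : rel V) : pred {ffun V * V -> bool} := fun z =>
  [&& [forall i, forall j, z (i, j) == z (j, i)],
      [forall i, forall j, z (i, j) ==> H i j] &
      [forall i, \sum_j z (i, j) == 0]].

Lemma even_subgraphsP H z :
  reflect [/\ forall i j, z (i, j) = z (j, i), forall i j, z (i, j) -> H i j &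
              forall i, \sum_j z (i, j) = 0] (even_subgraphs H z).
Proof.
apply: (iffP and3P) => [[/forallP h1 /forallP h2 /forallP h3]|[h1 h2 h3]].
  split=> i; last exact/eqP/h3.
    by move=> j; apply/eqP/(forallP (h1 i)).
  by move=> j; apply/implyP/(forallP (h2 i)).
split; apply/forallP => i; last exact/eqP.
  by apply/forallP => j; apply/eqP.
by apply/forallP => j; apply/implyP/h2.
Qed.

Lemma even_subgraphs0 H : even_subgraphs H 0.
Proof.
by apply/even_subgraphsP; split=> [i j|i j|i]; rewrite ?ffunE // big1 // => j; rewrite ffunE.
Qed.

Lemma even_subgraphsD H z z' :
  even_subgraphs H z -> even_subgraphs H z' -> even_subgraphs H (z + z').
Proof.
move=> /even_subgraphsP[a1 a2 a3] /even_subgraphsP[b1 b2 b3].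
apply/even_subgraphsP; split=> [i j|i j|i].
- by rewrite !ffunE a1 b1.
- by rewrite ffunE; move: (a2 i j) (b2 i j); do 2!case: (fun_of_fin _ _); auto.
- rewrite (eq_bigr (fun j => z (i, j) + z' (i, j))); last by move=> j; rewrite ffunE.
  by rewrite big_split /= a3 b3.
Qed.

Lemma ffun_addbb (z : {ffun V * V -> bool}) : z + z = 0.
Proof. by apply/ffunP => h; rewrite !ffunE; apply: addbb. Qed.

(* The cosets of the group of even subgraphs partition all edge sets, and
   subtracting a representative of its coset maps each coset bijectively onto
   that group: a uniform edge set is turned into a uniform even subgraph. *)
Definition round_to_even (H : rel V) s :=
  s + choose (fun t => even_subgraphs H (t + s)) s.

Lemma round_to_even_sub H s : even_subgraphs H (round_to_even H s).
Proof.
rewrite /round_to_even addrC.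
apply: (@chooseP _ (fun t => even_subgraphs H (t + s))).
by rewrite ffun_addbb even_subgraphs0.
Qed.

Lemma round_to_evenD H s z : even_subgraphs H z ->
  round_to_even H (s + z) = round_to_even H s + z.
Proof.
move=> Hz; rewrite /round_to_even addrAC; congr (_ + _ + _).
rewrite -(@eq_choose _ (fun t => even_subgraphs H (t + s))); last first.
  move=> t; apply/idP/idP => h.
    by rewrite addrA; apply: even_subgraphsD.
  have -> : t + s = t + (s + z) + z by rewrite addrA -[RHS]addrA ffun_addbb addr0.
  exact: even_subgraphsD.
by apply: choose_id; [rewrite addrAC ffun_addbb add0r|rewrite ffun_addbb even_subgraphs0].
Qed.

(** Adding [z] permutes the edge sets [s] and, by [round_to_evenD], toggles [(i, j)] in the rounded
    subgraph, so exactly half of them select this edge. *)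
Lemma round_to_even_half H z i j : even_subgraphs H z -> z (i, j) ->
  (2 * \sum_s round_to_even H s (i, j) = #|{: {ffun V * V -> bool}}|)%N.
Proof.
move=> Hz zij; rewrite mul2n -addnn.
have zI : injective (fun s => s + z) by exact: addIr.
rewrite {1}(reindex_inj zI) -big_split /= -[RHS]sum1_card; apply: eq_bigr => s _.
by rewrite round_to_evenD // ffunE zij; case: (round_to_even _ _ _).
Qed.

Definition fractional (d : nat) N : rel V := fun i j => 0 < N (i, j) < d%:Z.

(** With the default 0, symmetry, the bound by [z] and the zero sums hold for every [z]; a colouring
    is only needed to see that the default does not occur. *)
Definition choose_signing z : V -> V -> int :=
  if pselect (exists g, signing z g) is left e then projT1 (cid e)
  else fun _ _ => 0.

(** The second component of the seed is a global sign; summing over it cancels the cross terms in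
    the change of the squares. *)
Definition perturbation (d : nat) N (sd : {ffun V * V -> bool} * bool) i j : int :=
  (-1) ^+ sd.2 * choose_signing (round_to_even (fractional d N) sd.1) i j.

Lemma choose_signing_sym z i j : choose_signing z i j = choose_signing z j i.
Proof.
by rewrite /choose_signing; case: pselect => // e; case: (projT2 (cid e)).
Qed.

Lemma choose_signing_abs z i j : (`|choose_signing z i j| <= z (i, j))%N.
Proof.
by rewrite /choose_signing; case: pselect => // e; case: (projT2 (cid e)) => _ ->.
Qed.

Lemma choose_signing_sum z i : \sum_j choose_signing z i j = 0.
Proof.
rewrite /choose_signing; case: pselect => [e|_]; first by case: (projT2 (cid e)).
by rewrite big1.
Qed.

Lemma perturbation_sym d N sd i j : perturbation d N sd i j = perturbation d N sd j i.
Proof. by rewrite /perturbation choose_signing_sym. Qed.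

Lemma perturbation_sum d N sd i : \sum_j perturbation d N sd i j = 0.
Proof. by rewrite -mulr_sumr choose_signing_sum mulr0. Qed.

Lemma perturbation_abs d N sd i j :
  (`|perturbation d N sd i j| <= fractional d N i j)%N.
Proof.
rewrite /perturbation abszM abszX /= exp1n mul1n.
apply: leq_trans (choose_signing_abs _ _ _) _.
have /even_subgraphsP[_ h _] := round_to_even_sub (fractional d N) sd.1.
by move: (h i j); case: (fun_of_fin _ _) => // ->.
Qed.

Lemma sum_sqr_perturbation d N i :
  \sum_sd \sum_j ((N (i, j) + perturbation d N sd i j) ^+ 2 - N (i, j) ^+ 2) =
  2 * \sum_s \sum_j choose_signing (round_to_even (fractional d N) s) i j ^+ 2.
Proof.
rewrite -(pair_bigA _ (fun s b => \sum_j ((N (i, j) + perturbation d N (s, b) i j) ^+ 2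
  - N (i, j) ^+ 2))) /= mulr_sumr; apply: eq_bigr => s _.
rewrite big_bool /= -big_split mulr_sumr /=; apply: eq_bigr => j _.
rewrite /perturbation /= expr0 expr1; ring.
Qed.

Lemma sum_sqr_perturbation_ge0 d N i :
  0 <= \sum_sd \sum_j ((N (i, j) + perturbation d N sd i j) ^+ 2 - N (i, j) ^+ 2).
Proof.
rewrite sum_sqr_perturbation mulr_ge0 // sumr_ge0 // => s _.
by rewrite sumr_ge0 // => j _; apply: sqr_ge0.
Qed.

(** Half of the edge sets round to a subgraph containing [(i, j)], and then this edge contributes 1
    for either sign. The mean gain at [i] is therefore at least 1/2. *)
Lemma sum_sqr_perturbation_gain d N (c : V -> bool) z i j :
    (forall i j, N (i, j) != 0 -> c i != c j) ->
    even_subgraphs (fractional d N) z -> z (i, j) ->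
  (#|{: {ffun V * V -> bool} * bool}|%:Z <=
   2 * \sum_sd \sum_j ((N (i, j) + perturbation d N sd i j) ^+ 2 - N (i, j) ^+ 2)).
Proof.
move=> Nc Hz zij; rewrite sum_sqr_perturbation.
rewrite card_prod card_bool -(round_to_even_half Hz zij).
have -> : ((2 * \sum_s round_to_even (fractional d N) s (i, j)) * 2)%N%:Z =
  2 * (2 * \sum_s (round_to_even (fractional d N) s (i, j) : nat)%:Z).
  by rewrite -(big_morph Posz PoszD (erefl 0%:Z)); lia.
rewrite !ler_pM2l //; apply: ler_sum => s _.
rewrite (bigD1 j) //= -[leLHS]addr0 lerD //; last first.
  by apply: sumr_ge0 => k _; apply: sqr_ge0.
rewrite /choose_signing; case: pselect => [e|[]].
  case: (projT2 (cid e)) => _ h _; move: (h i j); move: (projT1 _ i j) => g.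
  case: (fun_of_fin _ _) => [g1|_]; last exact: sqr_ge0.
  by have [->|->] : g = 1 \/ g = -1 by lia.
have /even_subgraphsP[h1 h2 h3] := round_to_even_sub (fractional d N) s.
apply: (@signing_exists _ c) => // i' j' /h2 /andP[h _]; apply: Nc.
by rewrite gt_eqF.
Qed.

End Perturbation.

(** * Cycles through fractional edges and integrality on finite graphs *)

Section Cycles.
Variable V : finType.
Implicit Types (H : rel V) (z : {ffun V * V -> bool}) (N : {ffun V * V -> int}).

Definition edge_indicator (u v : V) : {ffun V * V -> bool} :=
  [ffun h => (h == (u, v)) (+) (h == (v, u))].

Lemma sum_edge_indicator u v i :
  \sum_j edge_indicator u v (i, j) = (i == u) (+) (i == v) :> bool.
Proof.
have sum1 (a b : V) : \sum_j ((i, j) == (a, b)) = (i == a) :> bool.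
  rewrite (bigD1 b) //= big1 ?addr0 ?xpair_eqE ?eqxx ?andbT // => j jb.
  by rewrite xpair_eqE (negPf jb) andbF.
rewrite -(sum1 u v) -(sum1 v u) -[RHS]big_split /=.
by apply: eq_bigr => j _; rewrite ffunE.
Qed.

(** The edges of a walk from [u] to [v], summed modulo 2, have boundary [u + v]. *)
Lemma walk_parity H u v : symmetric H -> connect H u v ->
  exists z, [/\ forall i j, z (i, j) = z (j, i), forall i j, z (i, j) -> H i j &
    forall i, \sum_j z (i, j) = (i == u) (+) (i == v) :> bool].
Proof.
move=> Hsym /connectP[p]; elim: p u => [|w p IHp] u /=.
  move=> _ ->; exists 0; split=> [i j|i j|i]; rewrite ?ffunE // addbb.
  by rewrite big1 // => j; rewrite ffunE.
move=> /andP[Huw /IHp{}IHp] /IHp[z [zC zH zs]].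
exists (z + edge_indicator u w); split=> [i j|i j|i].
- by rewrite !ffunE zC !xpair_eqE addbC ![_ && (i == _)]andbC [_ (+) (_ && _)]addbC.
- rewrite !ffunE; case zij: (z _); first by move=> _; apply: zH.
  by case: eqP => [[-> ->]//|_]; case: eqP => [[-> ->]|//]; rewrite Hsym.
- rewrite (eq_bigr (fun j => z (i, j) + edge_indicator u w (i, j))); last first.
    by move=> j _; rewrite ffunE.
  rewrite big_split /= zs sum_edge_indicator.
  by case: (i == w); case: (i == v); case: (i == u).
Qed.

Section Fractional.
Variables (d : nat) (N : {ffun V * V -> int}) (c : V -> bool).
Hypotheses (N_sym : forall i j, N (i, j) = N (j, i))
  (N_itv : forall i j, 0 <= N (i, j) <= d%:Z)
  (N_col : forall i j, N (i, j) != 0 -> c i != c j).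

Let F := fractional d N.

Lemma fractional_sym : symmetric F.
Proof. by move=> i j; rewrite /F /fractional N_sym. Qed.

Definition fractional_off u v : rel V :=
  fun i j => [&& F i j, (i, j) != (u, v) & (i, j) != (v, u)].

Lemma fractional_off_sym u v : symmetric (fractional_off u v).
Proof.
move=> i j; rewrite /fractional_off fractional_sym !xpair_eqE.
by rewrite andbA [j == u]eq_sym [j == v]eq_sym [i == v]eq_sym [i == u]eq_sym andbAC;
  rewrite -andbA; congr (_ && _); congr (~~ _ && ~~ _); rewrite ![_ == i]eq_sym ![_ == j]eq_sym andbC.
Qed.

(* Counting the values around a side of a bridge modulo d. *)
Lemma no_full_side a b : F a b ->
    ~~ connect (fractional_off a b) a b ->
    (forall i, connect (fractional_off a b) a i -> \sum_j N (i, j) = d%:Z) ->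
  False.
Proof.
move=> Fab nab full; pose S := connect (fractional_off a b) a.
pose sg i : int := if c i then 1 else -1.
have aS : S a by exact: connect0.
(* Weighted by colour, the two directions of an edge inside [S] cancel. *)
have inner0 : \sum_(i | S i) \sum_(j | S j) sg i * N (i, j) = 0.
  suff : \sum_(i | S i) \sum_(j | S j) sg i * N (i, j) =
         - \sum_(i | S i) \sum_(j | S j) sg i * N (i, j) by lia.
  rewrite {1}exchange_big /= -sumrN; apply: eq_bigr => i _.
  rewrite -sumrN; apply: eq_bigr => j _; rewrite N_sym -mulNr.
  have [->|Nij] := eqVneq (N (i, j)) 0; first by rewrite !mulr0.
  by move: (N_col Nij); rewrite /sg; case: (c i); case: (c j).
(* Any other edge leaving [S] is not fractional, otherwise its far end would belong to [S]; its
   value is 0 or [d]. *)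
have off i j : S i -> ~~ S j -> (i, j) != (a, b) -> (d %| N (i, j))%Z.
  move=> Si Sj ij; have ji : (i, j) != (b, a).
    by apply/eqP => -[ib _]; rewrite -/(S b) -ib Si in nab.
  have : ~~ F i j.
    apply: contra Sj => Fij; apply: connect_trans Si (connect1 _).
    by rewrite /fractional_off Fij ij ji.
  rewrite /F /fractional; have := N_itv i j => Nij Fij.
  by have [->|->] : N (i, j) = 0 \/ N (i, j) = d by lia.
have : (d %| \sum_(i | S i) \sum_(j | ~~ S j) sg i * N (i, j))%Z.
  have -> : \sum_(i | S i) \sum_(j | ~~ S j) sg i * N (i, j) =
      \sum_(i | S i) \sum_j sg i * N (i, j).
    rewrite [RHS](eq_bigr (fun i => \sum_(j | S j) sg i * N (i, j) +
      \sum_(j | ~~ S j) sg i * N (i, j))) => [|i _]; last exact: bigID.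
    by rewrite big_split /= inner0 add0r.
  by apply: rpred_sum => i Si; rewrite -mulr_sumr full // dvdz_mull.
(* Modulo [d] only the bridge [(a, b)] survives, so [d] would divide a value strictly between 0 and
   [d]. *)
rewrite (bigD1 a) //= (bigD1 b) //= -addrA rpredDr; last first.
  rewrite rpredD // rpred_sum // => i.
    by move=> /andP[Si ib]; rewrite dvdz_mull // off // xpair_eqE negb_and ib orbT.
  move=> /andP[Si ia]; rewrite rpred_sum // => j Sj.
  by rewrite dvdz_mull // off // xpair_eqE negb_and ia.
rewrite /sg; move: Fab; rewrite /F /fractional => Nab.
have -> : (d %| (if c a then 1 else -1) * N (a, b))%Z = (d %| N (a, b))%Z.
  by case: (c a); rewrite ?mul1r // mulN1r rpredN.
move=> /dvdzP[q qE]; rewrite qE in Nab; have d0 : 0 < d%:Z by lia.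
have [q0|q0] : q <= 0 \/ 1 <= q by lia.
  by nia.
by nia.
Qed.

Lemma fractional_offC a b : fractional_off a b =2 fractional_off b a.
Proof. by move=> i j; rewrite /fractional_off [X in _ && X]andbC. Qed.

(** [Q] stands for the vertices whose edges may leave the finite graph. If [uv] is not a bridge, a
    walk around it closes up to an even subgraph. If it is, [Q], being connected without [uv],
    misses one side, which [no_full_side] excludes. *)
Lemma fractional_edge_in_even_subgraph u v (Q : pred V) : F u v ->
    (forall i, connect F u i -> ~~ Q i -> \sum_j N (i, j) = d%:Z) ->
    (forall i j, Q i -> Q j -> connect F u i -> connect F u j ->
      connect (fractional_off u v) i j) ->
  exists2 z, even_subgraphs F z & z (u, v).
Proof.
move=> Fuv full Qc.
have csym := sym_connect_sym (fractional_off_sym u v).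
have uv : u != v.
  have /N_col : N (u, v) != 0 by move: Fuv; rewrite /F /fractional; lia.
  by apply: contra => /eqP ->.
have subF i j : connect (fractional_off u v) i j -> connect F i j.
  apply: connect_sub => {}i {}j /and3P[Fij _ _]; exact: connect1.
have [uv'|nuv] := boolP (connect (fractional_off u v) u v).
  have [z [zC zF zs]] := walk_parity (fractional_off_sym u v) uv'.
  exists (z + edge_indicator u v).
    apply/even_subgraphsP; split=> [i j|i j|i].
    - by rewrite !ffunE zC !xpair_eqE addbC ![_ && (i == _)]andbC [_ (+) (_ && _)]addbC.
    - rewrite !ffunE; case zij: (z _); first by have /and3P[] := zF _ _ zij.
      case: eqP => [[-> ->]//|_]; case: eqP => [[-> ->]|//].
      by rewrite fractional_sym.
    - rewrite (eq_bigr (fun j => z (i, j) + edge_indicator u v (i, j))).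
        by rewrite big_split /= zs sum_edge_indicator; apply: addbb.
      by move=> j _; rewrite ffunE.
  rewrite !ffunE eqxx xpair_eqE (negPf uv) /=.
  case zuv: (z _) => //; have := zF _ _ zuv.
  by rewrite /fractional_off eqxx andbF.
have no_side a b : F a b -> fractional_off u v =2 fractional_off a b ->
    connect F u a -> ~~ connect (fractional_off u v) a b ->
    (forall i, connect (fractional_off u v) a i -> ~~ Q i) -> False.
  move=> Fab offE ua nab nQ.
  apply: (no_full_side Fab); first by rewrite -(eq_connect offE).
  move=> i; rewrite -(eq_connect offE) => ai; apply: full (nQ _ ai).
  exact: connect_trans ua (subF _ _ ai).
exfalso.
have [/existsP[a /andP[ua Qa]]|] := boolP [exists a, connect (fractional_off u v) u a && Q a].
  apply: (@no_side v u).
  - by rewrite fractional_sym.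
  - exact: fractional_offC.
  - exact: connect1.
  - by rewrite csym.
  move=> b vb; apply: contra nuv => Qb.
  apply: (connect_trans ua); rewrite csym; apply: (connect_trans vb).
  apply: Qc Qb Qa _ _; last exact: (subF _ _ ua).
  exact: connect_trans (connect1 Fuv) (subF _ _ vb).
rewrite negb_exists => /forallP nQ.
apply: (@no_side u v) => // i ui; have := nQ i.
by rewrite ui.
Qed.

End Fractional.

(** Integrality of the perfect matching polytope of a bipartite graph. No edge leaves the graph, so
    [Q] is empty. Of two opposite shifts along an even subgraph one strictly raises the sum of
    squares [E], which is at most [B]: the induction is on [B - E N]. *)
Lemma integral_point d N (c : V -> bool) :
    (forall i j, N (i, j) = N (j, i)) -> (forall i j, 0 <= N (i, j) <= d%:Z) ->
    (forall i j, N (i, j) != 0 -> c i != c j) ->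
    (forall i, \sum_j N (i, j) = d%:Z) ->
  exists M : {ffun V * V -> int},
    [/\ forall i j, M (i, j) = M (j, i),
        forall i j, M (i, j) = 0 \/ M (i, j) = d%:Z,
        forall i j, N (i, j) = 0 -> M (i, j) = 0 &
        forall i, \sum_j M (i, j) = d%:Z].
Proof.
pose E (N : {ffun V * V -> int}) := \sum_h N h ^+ 2.
pose B : int := \sum_(h : V * V) d%:Z ^+ 2.
have [n] := ubnP `|B - E N|%N; elim: n N => // n IHn N ltEn NC Nitv Nc Ns.
have [/existsP[u /existsP[v Fuv]]|] := boolP [exists u, exists v, fractional d N u v];
  last first.
  rewrite negb_exists => /forallP nF; exists N; split=> // i j.
  have := nF i; rewrite negb_exists => /forallP/(_ j).
  by rewrite /fractional; have := Nitv i j; lia.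
have [||z Hz zuv] := fractional_edge_in_even_subgraph NC Nitv Nc (Q := xpred0) Fuv.
- by [].
- by [].
have /even_subgraphsP[zC zF zs] := Hz.
have [|g [gC gz gs]] := signing_exists (c := c) zC zs.
  by move=> i j /zF /andP[N0 _]; apply: Nc; rewrite gt_eqF.
have key (e : int) : e = 1 \/ e = -1 ->
    E N < \sum_h (N h + e * g h.1 h.2) ^+ 2 ->
  exists M : {ffun V * V -> int},
    [/\ forall i j, M (i, j) = M (j, i),
        forall i j, M (i, j) = 0 \/ M (i, j) = d%:Z,
        forall i j, N (i, j) = 0 -> M (i, j) = 0 &
        forall i, \sum_j M (i, j) = d%:Z].
  move=> e1 ltE; pose N' := [ffun h => N h + e * g h.1 h.2].
  have N'E i j : N' (i, j) = N (i, j) + e * g i j by rewrite ffunE.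
  have g0 i j : g i j != 0 -> 0 < N (i, j) < d%:Z.
    by have := gz i j; have := zF i j; case: (z _) => [/(_ isT) // | _]; lia.
  have N'itv i j : 0 <= N' (i, j) <= d%:Z.
    rewrite N'E; have := Nitv i j; have := g0 i j; have := gz i j.
    case: eqP => [->|_ g1 /(_ isT)]; first by rewrite mulr0 addr0.
    by case: e1 => ->; case: (z _) g1; lia.
  have N0 i j : N (i, j) = 0 -> N' (i, j) = 0.
    by move=> Nij; rewrite N'E; move: (g0 i j); rewrite Nij; case: eqP => [->|_ /(_ isT)//]; rewrite mulr0.
  have [|||||M [MC MI M0 Ms]] := IHn N'.
  - have EN' : E N' = \sum_h (N h + e * g h.1 h.2) ^+ 2.
      by apply: eq_bigr => h _; rewrite ffunE.
    have : E N' <= B.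
      by apply: ler_sum => -[i j] _; have /andP[? ?] := N'itv i j; rewrite lerXn2r ?nnegrE.
    by rewrite EN' in ltE *; lia.
  - by move=> i j; rewrite !N'E NC gC.
  - exact: N'itv.
  - by move=> i j N'ij; apply: Nc; apply: contra_neq N'ij; apply: N0.
  - move=> i; rewrite (eq_bigr (fun j => N (i, j) + e * g i j)) => [|j _]; last exact: N'E.
    by rewrite big_split /= Ns -mulr_sumr gs mulr0 addr0.
  by exists M; split=> // i j Nij; apply/M0/N0.
pose S e := \sum_h (N h + e * g h.1 h.2) ^+ 2.
have : 2 * E N < S 1 + S (-1).
  rewrite -big_split mulr_sumr /= -subr_gt0 -sumrB.
  rewrite (eq_bigr (fun h => 2 * g h.1 h.2 ^+ 2)) => [|h _]; last by ring.
  rewrite (bigD1 (u, v)) //= ltr_wpDr //.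
    by apply: sumr_ge0 => h _; rewrite mulr_ge0 // sqr_ge0.
  by have := gz u v; rewrite zuv => g1; have [->|->] : g u v = 1 \/ g u v = -1 by lia.
have [h _|h1 h2] := ltP (E N) (S 1).
  by apply: (key 1) => //; left.
have h3 : E N < S (-1) by lia.
by apply: (key (-1)) => //; right.
Qed.

End Cycles.

End EvenSubgraphs.

(** * Analytic sets, Lusin separation and Suslin's theorem *)

Section AnalyticSets.
Local Open Scope classical_set_scope.

Section Cells.
Variable W : topologicalType.

Definition cell_filter (c : nat -> nat -> set W) (s : nat -> nat) : set_system W :=
  [set U | exists n, forall w, (forall j, (j <= n)%N -> c j (s j) w) -> U w].

(* For a Polish space, c n is an enumeration of closed balls of radius
   1 / (n + 1) covering the space. *)
Record cells (c : nat -> nat -> set W) : Prop := Cells {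
  cells_closed : forall n i, closed (c n i);
  cells_cover : forall n w, exists i, c n i w;
  cells_cvg : forall s,
    (forall n, exists w, forall j, (j <= n)%N -> c j (s j) w) ->
    exists w : W, cell_filter c s --> w }.

(** All that is kept of Polishness: it suffices for Suslin's theorem and passes to products and
    finite powers without a product metric. *)
Definition has_cells := hausdorff_space W /\ exists c, cells c.

Lemma cell_filter_filter c s : Filter (cell_filter c s).
Proof.
split=> [|P Q [n nP] [m mQ]|P Q PQ [n nP]]; first by exists 0%N.
  exists (maxn n m) => w h; split.
    by apply: nP => j jn; apply: h; rewrite leq_max jn.
  by apply: mQ => j jn; apply: h; rewrite leq_max jn orbT.
by exists n => w /nP /PQ.
Qed.

(** The filter converges to some point, and [w] lies in every set of the filter, so the limit is [w]
    by separation. *)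
Lemma cells_base c s (w : W) : hausdorff_space W -> cells c ->
  (forall j, c j (s j) w) -> cell_filter c s --> w.
Proof.
move=> hW cc cw; have [|w' w'P] := cells_cvg cc (s := s); first by exists w.
suff -> : w = w' by [].
apply: hW => A B nA /w'P [n nB]; exists w; split; first exact: nbhs_singleton.
exact: nB.
Qed.

End Cells.

Definition agree (k : nat) (s t : nat -> nat) := forall i, (i < k)%N -> s i = t i.

(** Continuity from Baire space to the discrete space [T]. *)
Definition locally_constant T (F : (nat -> nat) -> T) :=
  forall s, exists k, forall t, agree k s t -> F t = F s.

(* Suslin's operation on closed sets. Letting [F n s] depend on any finite part
   of [s], not just on its first [n] entries, avoids recoding sequences. *)
Definition analytic (Z : topologicalType) (A : set Z) :=
  exists F : nat -> (nat -> nat) -> set Z,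
    [/\ forall n s, closed (F n s), forall n, locally_constant (F n) &
        A = [set z | exists s, forall n, F n s z]].

Section LocallyConstant.

Lemma agree_le k l s t : (k <= l)%N -> agree l s t -> agree k s t.
Proof. by move=> kl st i ik; apply: st; apply: leq_trans kl. Qed.

Lemma locally_constant_le T (F : nat -> (nat -> nat) -> T) n s :
  (forall n, locally_constant (F n)) ->
  exists k, forall t, agree k s t -> forall j, (j <= n)%N -> F j t = F j s.
Proof.
move=> lF; elim: n => [|n [k kP]].
  by have [k kP] := lF 0%N s; exists k => t /kP h j; rewrite leqn0 => /eqP ->.
have [l lP] := lF n.+1 s; exists (maxn k l) => t st j.
rewrite leq_eqVlt => /orP[/eqP ->|jn].
  by apply/lP/(agree_le _ st); rewrite leq_maxr.
by apply: kP => //; apply: agree_le st; rewrite leq_maxl.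
Qed.

Lemma locally_constant_comp T (F : (nat -> nat) -> T) (r : nat -> nat) :
  locally_constant F -> locally_constant (fun s => F (s \o r)).
Proof.
move=> lF s; have [k kP] := lF (s \o r).
exists (\max_(i < k) (r i).+1)%N => t st; apply: kP => i ik.
by apply: st; apply: (@leq_bigmax _ _ (Ordinal ik)).
Qed.

End LocallyConstant.

Section Analytic.
Variable Z : topologicalType.
Implicit Types A B : set Z.

Lemma closed_analytic A : closed A -> analytic A.
Proof.
move=> cA; exists (fun _ _ => A); split=> //; first by move=> n s; exists 0%N.
by apply/seteqP; split=> [z Az|z [_ /(_ 0%N)]//]; exists id.
Qed.

Lemma bigcup_analytic (A : nat -> set Z) :
  (forall m, analytic (A m)) -> analytic (\bigcup_m A m).
Proof.
move=> /choice[F FP].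
exists (fun n s => F (s 0%N) n (s \o S)); split=> [n s|n s|].
- by have [] := FP (s 0%N).
- have [_ lF _] := FP (s 0%N); have [k kP] := locally_constant_comp S (lF n) s.
  exists k.+1 => t st; rewrite -(st 0%N) //.
  by apply: kP; apply: agree_le st.
apply/seteqP; split=> [z [m _]|z [s sP]].
  have [_ _ ->] := FP m => -[s sP].
  by exists (fun i => if i is j.+1 then s j else m).
by exists (s 0%N) => //; have [_ _ ->] := FP (s 0%N); exists (s \o S).
Qed.

(** One sequence is cut into countably many columns, column [m] being the witness for [A m]. *)
Lemma bigcap_analytic (A : nat -> set Z) :
  (forall m, analytic (A m)) -> analytic (\bigcap_m A m).
Proof.
move=> /choice[F FP]; pose col (m i : nat) := pickle (m, i).
exists (fun q s => if unpickle q is Some (m, n) then F m n (s \o col m) else setT).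
split=> [q s|q s|].
- case: (unpickle q) => [[m n]|]; last exact: closedT.
  by have [] := FP m.
- case: (unpickle q) => [[m n]|]; last by exists 0%N.
  by have [_ lF _] := FP m; have [k kP] := locally_constant_comp (col m) (lF n) s; exists k.
apply/seteqP; split=> [z zA|z [s sP] m _].
  have /choice[s sP] m : exists s, forall n, F m n s z.
    by have := zA m I; have [_ _ ->] := FP m.
  exists (fun q => if unpickle q is Some (m, i) then s m i else 0%N) => q.
  case: (unpickle q) => [[m n]|//].
  rewrite (_ : _ \o _ = s m) //; apply/funext => i.
  by rewrite /= /col (@pickleK (nat * nat)%type).
have [_ _ ->] := FP m; exists (s \o col m) => n.
by have := sP (pickle (m, n)); rewrite pickleK.
Qed.

Lemma analytic0 : analytic (@set0 Z).
Proof. exact/closed_analytic/closed0. Qed.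

Lemma analyticT : analytic (@setT Z).
Proof. exact/closed_analytic/closedT. Qed.

Lemma analyticU A B : analytic A -> analytic B -> analytic (A `|` B).
Proof.
move=> aA aB; rewrite -bigcup2E; apply: bigcup_analytic => -[|[|m]] //=.
exact: analytic0.
Qed.

Lemma analyticI A B : analytic A -> analytic B -> analytic (A `&` B).
Proof.
move=> aA aB; rewrite -bigcap2E; apply: bigcap_analytic => -[|[|m]] //=.
exact: analyticT.
Qed.

Lemma analytic_ex (J : countType) (A : J -> set Z) :
  (forall i, analytic (A i)) -> analytic [set z | exists i, A i z].
Proof.
move=> aA; have -> : [set z | exists i, A i z] =
    \bigcup_m (if unpickle m is Some i then A i else set0).
  apply/seteqP; split=> [z [i Ai]|z [m _]].
    by exists (pickle i) => //; rewrite pickleK.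
  by case: (unpickle m) => // i; exists i.
apply: bigcup_analytic => m; case: (unpickle m) => [i|]; [exact: aA|exact: analytic0].
Qed.

Lemma analytic_all (J : countType) (A : J -> set Z) :
  (forall i, analytic (A i)) -> analytic [set z | forall i, A i z].
Proof.
move=> aA; have -> : [set z | forall i, A i z] =
    \bigcap_m (if unpickle m is Some i then A i else setT).
  apply/seteqP; split=> [z zA m _|z zA i].
    by case: (unpickle m).
  by have := zA (pickle i) I; rewrite pickleK.
apply: bigcap_analytic => m; case: (unpickle m) => [i|]; [exact: aA|exact: analyticT].
Qed.

Lemma analytic_const (P : Prop) : analytic [set _ : Z | P].
Proof.
have [p|np] := pselect P.
  have -> : [set _ : Z | P] = setT by apply/seteqP; split.
  exact: analyticT.
have -> : [set _ : Z | P] = set0 by apply/seteqP; split.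
exact: analytic0.
Qed.

(** An open set is the union of the countably many finite intersections of closed cells that it
    contains. *)
Lemma open_analytic : has_cells Z -> forall A, open A -> analytic A.
Proof.
move=> [hZ [c cc]] A oA.
have -> : A = [set z | exists l : seq nat,
    [set z | forall j, (j < size l)%N -> c j (nth 0%N l j) z] z /\
    ([set z | forall j, (j < size l)%N -> c j (nth 0%N l j) z] `<=` A)].
  apply/seteqP; split=> [z Az|z [l [lz]]]; last by apply.
  have /choice[s sP] := fun n => cells_cover cc n z.
  have [|n nP] := cells_base hZ cc sP (_ : nbhs z A); first exact: open_nbhs_nbhs.
  have nthE j : (j < n.+1)%N -> nth 0%N (mkseq s n.+1) j = s j by move=> jn; rewrite nth_mkseq.
  exists (mkseq s n.+1); rewrite size_mkseq; split=> [j jn|w wP].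
    by rewrite nthE.
  by apply: nP => j jn; rewrite -nthE //; apply: wP.
apply: analytic_ex => l; apply: analyticI; last exact: analytic_const.
apply: closed_analytic.
rewrite (_ : mkset _ = \bigcap_(j in [set j | (j < size l)%N]) c j (nth 0%N l j)) //.
by apply: closed_bigI => j _; apply: (cells_closed cc).
Qed.

(** The sets that are analytic together with their complement form a sigma-algebra containing the
    open sets. *)
Lemma borel_analytic A : has_cells Z -> borel_set A -> analytic A.
Proof.
move=> hZ bA; suff [] : analytic A /\ analytic (~` A) by [].
apply: (bA (fun A => analytic A /\ analytic (~` A))); split.
  split=> [|B [aB aCB]|F FP].
  - by rewrite setC0; split; [exact: analytic0|exact: analyticT].
  - by rewrite setTD setCK.
  - rewrite setC_bigcup; split.
      by apply: bigcup_analytic => m; have [] := FP m.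
    by apply: bigcap_analytic => m; have [] := FP m.
by move=> B oB; split; [exact: open_analytic|exact/closed_analytic/open_closedC].
Qed.

End Analytic.

Lemma preimage_analytic (Y Z : topologicalType) (f : Y -> Z) (A : set Z) :
  continuous f -> analytic A -> analytic (f @^-1` A).
Proof.
move=> fC [F [cF lF ->]]; exists (fun n s => f @^-1` F n s); split=> // n s.
  by apply: closed_comp => // x _; exact: fC.
by have [k kP] := lF n s; exists k => t /kP ->.
Qed.

(** The even entries of the code name cells that pin down [w], the odd ones are the code for [B].
    Projections of closed sets need not be closed, hence the closures; convergence of the cells
    makes them harmless. *)
Lemma exists_analytic (Z W : topologicalType) (B : set (Z * W)) :
  has_cells W -> analytic B -> analytic [set z | exists w, B (z, w)].
Proof.
move=> [hW [c cc]] [F [cF lF ->]].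
pose ev (s : nat -> nat) := s \o double; pose od (s : nat -> nat) := s \o (fun i => i.*2.+1).
pose D n s := [set z | exists w, (forall j, (j <= n)%N -> c j (ev s j) w) /\
  (forall j, (j <= n)%N -> F j (od s) (z, w))].
exists (fun n s => closure (D n s)); split=> [n s|n s|].
- exact: closed_closure.
- have [k kP] := @locally_constant_le _ (fun j s => F j (od s)) n s
    (fun j => locally_constant_comp _ (lF j)).
  have lc (j : nat) : locally_constant (fun s => c j (ev s j)).
    by move=> r; exists j.*2.+1 => t rt; rewrite /ev /= rt.
  have [l lP] := @locally_constant_le _ (fun j s => c j (ev s j)) n s lc.
  exists (maxn k l) => t st; congr closure; apply/seteqP.
  have h1 j : (j <= n)%N -> F j (od t) = F j (od s).
    by apply: kP; apply: agree_le st; rewrite leq_maxl.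
  have h2 j : (j <= n)%N -> c j (ev t j) = c j (ev s j).
    by apply: lP; apply: agree_le st; rewrite leq_maxr.
  split=> z [w [cw Fw]]; exists w; split=> j jn.
  - by rewrite -h2 //; apply: cw.
  - by rewrite -h1 //; apply: Fw.
  - by rewrite h2 //; apply: cw.
  - by rewrite h1 //; apply: Fw.
apply/seteqP; split=> [z [w [s sP]]|z [s sP]].
  have /choice[r rP] := fun n => cells_cover cc n w.
  exists (fun i => if odd i then s i./2 else r i./2) => n; apply: subset_closure.
  exists w; split=> j jn; first by rewrite /ev /= odd_double doubleK.
  rewrite (_ : od _ = s) //; apply/funext => i.
  by rewrite /od /= odd_double /= uphalf_double.
have [|w wP] := cells_cvg cc (s := ev s).
  move=> n; have [z' [[w [wP _]] _]] := sP n setT filterT.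
  by exists w.
(* As [F k] is closed, points near [(z, w)] are enough: [D] has points with first coordinate close
   to [z], and their second coordinates lie in the named cells, hence close to [w]. *)
exists w; exists (od s) => k; apply: cF => U [[V V'] [/= nV nV'] VU].
have [n0 n0P] := wP _ nV'.
have [z' [[w' [cw' Fw']] Vz']] := sP (maxn k n0) _ nV.
exists (z', w'); split; first by apply: Fw'; rewrite leq_maxl.
by apply: VU; split=> //=; apply: n0P => j jn; apply: cw'; rewrite leq_max jn orbT.
Qed.

Section BorelSets.
Variable Z : topologicalType.
Implicit Types A B : set Z.

Lemma borel_set_open A : open A -> borel_set A.
Proof. exact: sub_sigma_algebra. Qed.

Lemma borel_setC A : borel_set A -> borel_set (~` A).
Proof. by move=> bA; have := sigma_algebraCD bA; rewrite setTD. Qed.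

Lemma borel_bigcup (A : nat -> set Z) :
  (forall n, borel_set (A n)) -> borel_set (\bigcup_n A n).
Proof. by move=> bA; apply: sigma_algebra_bigcup. Qed.

Lemma borel_bigcap (A : nat -> set Z) :
  (forall n, borel_set (A n)) -> borel_set (\bigcap_n A n).
Proof.
move=> bA; rewrite -[X in borel_set X]setCK setC_bigcap.
by apply: borel_setC; apply: borel_bigcup => n; apply: borel_setC.
Qed.

Definition borel_separated A B := exists D, [/\ borel_set D, A `<=` D & B `<=` ~` D].

Lemma borel_separated_bigcup (A B : nat -> set Z) :
  (forall i j, borel_separated (A i) (B j)) ->
  borel_separated (\bigcup_i A i) (\bigcup_j B j).
Proof.
move=> /(_ _)/choice => sAB.
have /choice[D DP] i : exists D : nat -> set Z, forall j,
    [/\ borel_set (D j), A i `<=` D j & B j `<=` ~` D j].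
  by have [D DP] := sAB i; exists D.
exists (\bigcup_i \bigcap_j D i j); split.
- by apply: borel_bigcup => i; apply: borel_bigcap => j; have [] := DP i j.
- by move=> z [i _ Aiz]; exists i => // j _; have [_ AD _] := DP i j; apply: AD.
- move=> z [j _ Bjz] [i _ /(_ j Logic.I)]; have [_ _ BD] := DP i j.
  exact: BD.
Qed.

End BorelSets.

(** * Lusin's separation theorem *)

Section LusinSeparation.
Variables (Z : topologicalType) (c : nat -> nat -> set Z).
Hypotheses (hZ : hausdorff_space Z) (cc : cells c).

Let ev (s : nat -> nat) := s \o double.
Let od (s : nat -> nat) := s \o (fun i => i.*2.+1).

Let P (F : nat -> (nat -> nat) -> set Z) s z :=
  forall n, F n (od s) z /\ c n (ev s n) z.

(** The points having a code that extends [l]; as in [exists_analytic], even entries name cells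
    around the point and odd entries are a code for the analytic set. *)
Let piece F (l : seq nat) : set Z :=
  [set z | exists2 s, (forall i, (i < size l)%N -> s i = nth 0%N l i) & P F s z].

Lemma piece_nil F : [set z | exists s, forall n, F n s z] `<=` piece F [::].
Proof.
move=> z [s sP]; have /choice[r rP] := fun n => cells_cover cc n z.
exists (fun i => if odd i then s i./2 else r i./2) => // n.
rewrite /ev /= odd_double doubleK; split=> //.
rewrite (_ : od _ = s) //; apply/funext => i.
by rewrite /od /= odd_double /= uphalf_double.
Qed.

Lemma piece_rcons F l : piece F l = \bigcup_a piece F (rcons l a).
Proof.
apply/seteqP; split=> [z [s sl sP]|z [a _ [s sl sP]]].
  exists (s (size l)) => //; exists s => // i.
  rewrite size_rcons ltnS leq_eqVlt nth_rcons => /orP[/eqP ->|il].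
    by rewrite ltnn eqxx.
  by rewrite il sl.
exists s => // i il; rewrite sl ?size_rcons; last by apply: ltnW.
by rewrite nth_rcons il.
Qed.

(** The cells named along the branch converge to a point [z]. Each closed set [F n] of the branch
    contains it, because points of all late pieces lie in [F n] and tend to [z]. *)
Lemma piece_limit F (l : nat -> seq nat) :
    (forall n s, closed (F n s)) -> (forall n, locally_constant (F n)) ->
    (forall n, exists a, l n.+1 = rcons (l n) a) -> l 0%N = [::] ->
    (forall n, piece F (l n) !=set0) ->
  exists2 z, [set z | exists s, forall n, F n s z] z &
    forall U, nbhs z U -> exists n, piece F (l n) `<=` U.
Proof.
move=> cF lF lS l0 ne.
have sz n : size (l n) = n.
  by elim: n => [|n IHn]; [rewrite l0|have [a ->] := lS n; rewrite size_rcons IHn].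
pose s i := nth 0%N (l i.+1) i.
have nthl n i : (i < n)%N -> nth 0%N (l n) i = s i.
  elim: n => // n IHn; rewrite ltnS leq_eqVlt => /orP[/eqP ->//|ilt].
  by have [a ->] := lS n; rewrite nth_rcons sz ilt IHn.
have pieceE n z : piece F (l n) z -> exists2 t, agree n s t & P F t z.
  by move=> [t tl tP]; exists t => // i il; rewrite tl ?sz // nthl.
have cellP n w : piece F (l n.*2.+1) w -> forall j, (j <= n)%N -> c j (ev s j) w.
  move=> /pieceE[t st tP] j jn; have [_] := tP j.
  by rewrite /ev /= -st // ltnS leq_double.
have [|z zP] := cells_cvg cc (s := ev s).
  by move=> n; have [w wP] := ne n.*2.+1; exists w; apply: cellP.
exists z; last first.
  move=> U /zP[n nP]; exists n.*2.+1 => w /cellP; exact: nP.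
exists (od s) => n; apply: cF => U /zP[m mP].
have [k kP] := locally_constant_comp (fun i => i.*2.+1) (lF n) s.
have [w wP] := ne (maxn k m.*2.+1); exists w; split.
  have [t st tP] := pieceE _ _ wP; have [+ _] := tP n.
  have := kP t; rewrite -/(od s) -/(od t) => -> //.
  by apply: agree_le st; rewrite leq_maxl.
apply: mP => j jm; have [t st tP] := pieceE _ _ wP; have [_] := tP j.
by rewrite /ev /= -st // leq_max orbC ltnS leq_double jm.
Qed.

(** If [A] and [B] are not separated, then by [borel_separated_bigcup] some pair of pieces is not
    separated at every depth. The two branches converge to points of [A] and of [B]; these differ,
    so disjoint open sets separate late pieces after all. *)
Lemma lusin_separation (A B : set Z) : analytic A -> analytic B ->
  A `&` B = set0 -> borel_separated A B.
Proof.
move=> [F [cF lF AE]] [E [cE lE BE]] AB0; apply: contrapT => nsep.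
pose T := {p : seq nat * seq nat | ~ borel_separated (piece F p.1) (piece E p.2)}.
pose R (x y : T) := exists a b, (sval y).1 = rcons (sval x).1 a /\
  (sval y).2 = rcons (sval x).2 b.
have RP (x : T) : {y : T | R x y}.
  apply/cid; case: x => -[l m] /= nlm; apply: contrapT => nR; have := nlm; apply.
  rewrite (piece_rcons F) (piece_rcons E); apply: borel_separated_bigcup => a b.
  apply: contrapT => nab; apply: nR.
  by exists (exist _ (rcons l a, rcons m b) nab); exists a, b.
have x0P : ~ borel_separated (piece F [::]) (piece E [::]).
  move=> [D [bD FD ED]]; apply: nsep; exists D; split=> //.
    by rewrite AE => z /piece_nil/FD.
  by rewrite BE => z /piece_nil/ED.
have [f [f0 fS]] := dependent_choice RP (exist _ ([::], [::]) x0P).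
have lim G (p : seq nat * seq nat -> seq nat) := @piece_limit G (fun n => p (sval (f n))).
(* An empty piece would be separated from anything. *)
have neF n : piece F (sval (f n)).1 !=set0.
  apply: contrapT => /set0P/negP/negPn/eqP e; apply: (svalP (f n)); rewrite e.
  by exists set0; split=> //; [exact: sigma_algebra0|move=> ? _].
have neE n : piece E (sval (f n)).2 !=set0.
  apply: contrapT => /set0P/negP/negPn/eqP e; apply: (svalP (f n)); rewrite e.
  exists setT; split=> //.
  by rewrite -setC0; apply: borel_setC; exact: sigma_algebra0.
have [||z Fz zF] := lim F fst cF lF _ _ neF.
- by move=> n; have [a [b [e _]]] := fS n; exists a.
- by rewrite f0.
have [||w Ew wE] := lim E snd cE lE _ _ neE.
- by move=> n; have [a [b [_ e]]] := fS n; exists b.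
- by rewrite f0.
have zw : z <> w.
  move=> zw; have Az : A z by rewrite AE.
  have Bz : B z by rewrite BE zw.
  by have : (A `&` B) z by []; rewrite AB0.
have mono G (p : seq nat * seq nat -> seq nat) :
    (forall n, exists a, p (sval (f n.+1)) = rcons (p (sval (f n))) a) ->
    forall n m, (n <= m)%N -> piece G (p (sval (f m))) `<=` piece G (p (sval (f n))).
  move=> pS n m /subnK <-; elim: (m - n)%N => // k IHk.
  apply: subset_trans IHk; rewrite addSn; have [a ->] := pS (k + n)%N.
  by move=> v va; rewrite piece_rcons; exists a.
move: hZ; rewrite open_hausdorff => /(_ z w)[|[U V] /= [zU wV] [oU oV UV0]].
  exact/eqP.
rewrite inE in zU; rewrite inE in wV.
have [n nP] := zF U (open_nbhs_nbhs (conj oU zU)).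
have [m mP] := wE V (open_nbhs_nbhs (conj oV wV)).
apply: (svalP (f (maxn n m))); exists U; split; first exact: borel_set_open.
  apply: subset_trans nP; apply: (mono F fst); last exact: leq_maxl.
  by move=> k; have [a [b [e _]]] := fS k; exists a.
have : piece E (sval (f (maxn n m))).2 `<=` V.
  apply: subset_trans mP; apply: (mono E snd); last exact: leq_maxr.
  by move=> k; have [a [b [_ e]]] := fS k; exists b.
move=> EV v /EV Vv Uv; move/eqP: UV0 => UV0.
by have : (U `&` V) v by []; rewrite UV0.
Qed.

End LusinSeparation.

Lemma suslin (Z : topologicalType) (A : set Z) : has_cells Z ->
  analytic A -> analytic (~` A) -> borel_set A.
Proof.
move=> [hZ [c cc]] aA aC.
have [D [bD AD CD]] := lusin_separation hZ cc aA aC (setICr A).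
suff -> : A = D by [].
by apply/seteqP; split=> // z Dz; apply: contrapT => /CD.
Qed.

(** * Cells for Polish spaces, products and finite powers *)

Section CellConstructions.

Lemma polish_has_cells (R : realType) (X : topologicalType) : inhabited X ->
  polish R X -> has_cells X.
Proof.
move=> [x0] [[D /countable_injP[i Di] dD] [M [f [g [fK gK fC gC compl]]]]].
split.
  move=> p q pq; apply: (can_inj fK); apply: (@metric_hausdorff R M).
  move=> A B nA nB; have [z [Az Bz]] := pq (f @^-1` A) (f @^-1` B) (fC _ _ nA) (fC _ _ nB).
  by exists (f z).
have /choice[q qP] n : exists x, forall y, D y -> i y = n -> x = y.
  have [[y [Dy iy]]|ny] := pselect (exists y, D y /\ i y = n).
    exists y => z Dz iz; apply: Di; rewrite ?inE //; congruence.
  by exists x0 => y Dy iy; case: ny; exists y.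
pose e n : R := n.+1%:R^-1%R.
have e0 n : (0 < e n)%R by rewrite invr_gt0 ltr0n.
pose c n k := f @^-1` closure (ball (f (q k)) (e n)).
exists c; split.
- by move=> n k; apply: closed_comp => [x _|]; [exact: fC|exact: closed_closure].
- move=> n x; have nb : nbhs x (f @^-1` (ball (f x) (e n))).
    by apply: fC; apply: nbhsx_ballx.
  move: nb; rewrite nbhsE => -[U [oU Ux] Ub].
  have [|y [Uy Dy]] := dD U _ oU; first by exists x.
  exists (i y) => /=; apply: subset_closure; rewrite (qP _ _ Dy erefl).
  by apply: ball_sym; apply: Ub.
move=> s sP; pose F := cell_filter c s.
have FF : Filter F by exact: cell_filter_filter.
have PF : ProperFilter F.
  by split=> // -[n nP]; have [w wP] := sP n; apply: (nP w).
have cau : cauchy (f @ F).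
  (* This index makes twice the radius at most [eps]: cells are closures of balls, and the second
     radius pays for the closure. *)
  apply: cauchy_exP => eps eps0; exists (f (q (s (Num.truncn (2 / eps)%R)))).
  exists (Num.truncn (2 / eps)%R) => w /(_ _ (leqnn _)); set m := Num.truncn _ => wm.
  have em : (e m + e m <= eps)%R.
    have h : (2 / eps < m.+1%:R)%R by rewrite real_truncnS_gt ?num_real.
    rewrite -mulr2n -mulr_natl /e ler_pdivrMr ?ltr0n // mulrC -ler_pdivrMr //.
    exact: ltW.
  apply: le_ball em _ _.
  have [v [bv vw]] := wm _ (nbhsx_ballx (f w) (e m) (e0 m)).
  by apply: ball_triangle bv _; apply: ball_sym.
have [l Fl] := compl (f @ F) _ cau.
exists (g l) => U nU; have {}nU := gC _ _ nU; have : F (f @^-1` (g @^-1` U)) by exact: Fl.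
by rewrite (_ : _ @^-1` _ = U) //; apply/seteqP; split=> x /=; rewrite fK.
Qed.

Lemma prod_has_cells (X Y : topologicalType) :
  has_cells X -> has_cells Y -> has_cells (X * Y)%type.
Proof.
move=> [hX [c cc]] [hY [d dd]]; split.
  move=> [x y] [x' y'] h; congr (_, _).
    apply: hX => A B nA nB.
    have [] := h (A `*` setT) (B `*` setT).
    - by exists (A, setT) => //; split=> //; exact: filterT.
    - by exists (B, setT) => //; split=> //; exact: filterT.
    by move=> [z w] [[Az _] [Bz _]]; exists z.
  apply: hY => A B nA nB.
  have [] := h (setT `*` A) (setT `*` B).
  - by exists (setT, A) => //; split=> //; exact: filterT.
  - by exists (setT, B) => //; split=> //; exact: filterT.
  by move=> [z w] [[_ Aw] [_ Bw]]; exists w.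
pose dec (k : nat) : nat * nat := odflt (0, 0)%N (unpickle k).
exists (fun n k => fst @^-1` c n (dec k).1 `&` snd @^-1` d n (dec k).2); split.
- move=> n k; apply: closedI; apply: closed_comp => //.
  + by move=> z _; apply: cvg_fst.
  + exact: cells_closed cc _ _.
  + by move=> z _; apply: cvg_snd.
  + exact: cells_closed dd _ _.
- move=> n [x y]; have [i ci] := cells_cover cc n x; have [j dj] := cells_cover dd n y.
  by exists (pickle (i, j)); rewrite /dec pickleK.
move=> s sP.
have [|x xP] := cells_cvg cc (s := fun n => (dec (s n)).1).
  by move=> n; have [[x y] xy] := sP n; exists x => j /xy[].
have [|y yP] := cells_cvg dd (s := fun n => (dec (s n)).2).
  by move=> n; have [[? y] xy] := sP n; exists y => j /xy[].
exists (x, y) => U [[A B] /= [/xP[n nA] /yP[m mB]] AB].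
exists (maxn n m) => -[z w] zw; apply: AB; split=> /=.
  by apply: nA => j jn; have [] := zw j; rewrite // leq_max jn.
by apply: mB => j jm; have [] := zw j; rewrite // leq_max jm orbT.
Qed.

Lemma ffun_has_cells (X : topologicalType) (k : nat) :
  has_cells X -> has_cells {ptws 'I_k -> X}.
Proof.
move=> [hX [c cc]]; split; first exact: hausdorff_product.
pose dec (m : nat) : {ffun 'I_k -> nat} := odflt [ffun=> 0%N] (unpickle m).
exists (fun n m => \bigcap_(i : 'I_k) (fun w : {ptws 'I_k -> X} => w i) @^-1` c n (dec m i)).
split.
- move=> n m; apply: closed_bigI => i _; apply: closed_comp.
    by move=> w _; apply: proj_continuous.
  exact: cells_closed cc _ _.
- move=> n w; have /choice[r rP] := fun i => cells_cover cc n (w i).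
  by exists (pickle [ffun i => r i]) => i _; rewrite /dec pickleK /= ffunE.
move=> s sP.
have /choice[w wP] i : exists w : X, cell_filter c (fun n => dec (s n) i) --> w.
  apply: (cells_cvg cc) => n; have [w wn] := sP n.
  by exists (w i) => j /wn/(_ i Logic.I).
exists w; have FF := @cell_filter_filter _ (fun n m => \bigcap_(i : 'I_k)
  (fun w : {ptws 'I_k -> X} => w i) @^-1` c n (dec m i)) s.
apply/cvg_sup => i; apply/cvg_image => [|U /wP[n nU]].
  by apply/seteqP; split=> // y _; exists (dfwith w i y) => //; rewrite dfwithin.
exists ((fun w : {ptws 'I_k -> X} => w i) @^-1` U).
  by exists n => v vP; apply: nU => j /vP/(_ i Logic.I).
apply/seteqP; split=> [x [v /= Uv <-] //|x Ux].
by exists (dfwith w i x) => /=; rewrite dfwithin.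
Qed.

End CellConstructions.

(* By Suslin's theorem such a map is Borel, see [amap_borel]: the preimages of
   points partition the space, so their complements are analytic as well. *)
Definition amap (Z : topologicalType) (V : countType) (h : Z -> V) :=
  forall v, analytic [set z | h z = v].

Section Amap.
Variable Z : topologicalType.
Implicit Types V U : countType.

Lemma amap_pred V (h : Z -> V) (P : V -> Prop) :
  amap h -> analytic [set z | P (h z)].
Proof.
move=> ah; rewrite (_ : mkset _ = [set z | exists v, ([set z | h z = v] `&` [set _ | P v]) z]).
  by apply: analytic_ex => v; apply: analyticI => //; exact: analytic_const.
by apply/seteqP; split=> [z Pz|z [v /= [<-]]//]; exists (h z).
Qed.

Lemma amap_bool (h : Z -> bool) : amap h -> analytic [set z | h z].
Proof. exact: amap_pred. Qed.

Lemma amap_comp V U (h : Z -> V) (F : V -> U) : amap h -> amap (fun z => F (h z)).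
Proof. by move=> ah v; apply: (amap_pred (fun u => F u = v)). Qed.

Lemma amap_cst V (v : V) : amap (fun _ : Z => v).
Proof. by move=> u; apply: (analytic_const Z (v = u)). Qed.

Lemma amap_pair V U (h : Z -> V) (k : Z -> U) :
  amap h -> amap k -> amap (fun z => (h z, k z)).
Proof.
move=> ah ak [v u]; rewrite (_ : mkset _ = [set z | h z = v] `&` [set z | k z = u]).
  exact: analyticI.
by apply/seteqP; split=> [z [<- <-]|z /= [-> ->]].
Qed.

Lemma amap_comp2 V U V' (h : Z -> V) (k : Z -> U) (F : V -> U -> V') :
  amap h -> amap k -> amap (fun z => F (h z) (k z)).
Proof. by move=> ah ak; apply: (amap_comp (fun p => F p.1 p.2) (amap_pair ah ak)). Qed.

Lemma amap_ffun V (I : finType) (h : I -> Z -> V) :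
  (forall i, amap (h i)) -> amap (fun z => [ffun i => h i z]).
Proof.
move=> ah f; rewrite (_ : mkset _ = [set z | forall i, [set z | h i z = f i] z]).
  by apply: analytic_all => i; apply: ah.
by apply/seteqP; split=> [z <- i|z zf]; [|apply/ffunP=> i]; rewrite /= ffunE //; apply: zf.
Qed.

Lemma amap_all (I : finType) (h : I -> Z -> bool) :
  (forall i, amap (h i)) -> amap (fun z => [forall i, h i z]).
Proof.
move=> /amap_ffun/(amap_comp (fun f : {ffun I -> bool} => [forall i, f i])) ah v.
rewrite (_ : mkset _ = [set z | [forall i, [ffun i => h i z] i] = v]); first exact: ah.
by apply/seteqP; split=> z /= <-; apply: eq_forallb => i; rewrite ffunE.
Qed.

Lemma amap_exists (I : finType) (h : I -> Z -> bool) :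
  (forall i, amap (h i)) -> amap (fun z => [exists i, h i z]).
Proof.
move=> ah; have -> : (fun z => [exists i, h i z]) = (fun z => ~~ [forall i, ~~ h i z]).
  by apply/funext => z; rewrite negb_forall; apply: eq_existsb => i; rewrite negbK.
by apply: (amap_comp negb); apply: amap_all => i; apply: (amap_comp negb).
Qed.

Lemma amap_sum (I : finType) (h : I -> Z -> int) :
  (forall i, amap (h i)) -> amap (fun z => \sum_i h i z)%R.
Proof.
move=> /amap_ffun/(amap_comp (fun f : {ffun I -> int} => \sum_i f i)%R) ah v.
rewrite (_ : mkset _ = [set z | (\sum_i [ffun i => h i z] i)%R = v]); first exact: ah.
by apply/seteqP; split=> z /= <-; apply: eq_bigr => i _; rewrite ffunE.
Qed.

Lemma amap_asbool (P : set Z) : analytic P -> analytic (~` P) -> amap (fun z => `[< P z >]).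
Proof.
move=> aP aC [].
  by rewrite (_ : mkset _ = P) //; apply/seteqP; split=> z /asboolP.
rewrite (_ : mkset _ = ~` P) //; apply/seteqP; split=> z /=.
  by move=> /asboolP.
by move=> nP; apply/asboolP.
Qed.

Lemma amap_subst V (Y : topologicalType) (f : Y -> Z) (h : Z -> V) :
  continuous f -> amap h -> amap (fun y => h (f y)).
Proof. by move=> fC ah v; apply: (preimage_analytic fC (ah v)). Qed.

Hypothesis cZ : has_cells Z.

Lemma amap_borel V (h : Z -> V) (P : V -> Prop) : amap h -> borel_set [set z | P (h z)].
Proof.
move=> ah; apply: suslin => //; first exact: amap_pred.
exact: (amap_pred (fun v => ~ P v)).
Qed.

Lemma borel_amap (A : set Z) : borel_set A -> amap (fun z => `[< A z >]).
Proof.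
move=> bA; apply: amap_asbool; apply: borel_analytic => //.
exact: borel_setC.
Qed.

End Amap.

Section Continuity.

Lemma pair_continuous (Y Z W : topologicalType) (f : Y -> Z) (g : Y -> W) :
  continuous f -> continuous g -> continuous (fun y => (f y, g y)).
Proof. by move=> fC gC y; apply: cvg_pair; [exact: fC|exact: gC]. Qed.

Lemma coord_continuous (X : topologicalType) k (i : 'I_k) :
  continuous (fun w : {ptws 'I_k -> X} => w i).
Proof. exact: proj_continuous. Qed.

Lemma continuous_comp2 (Y Z W : topologicalType) (f : Y -> Z) (g : Z -> W) :
  continuous f -> continuous g -> continuous (fun y => g (f y)).
Proof. by move=> fC gC y; apply: continuous_comp; [exact: fC|exact: gC]. Qed.

Lemma ptws_continuous (Y X : topologicalType) k (f : Y -> {ptws 'I_k -> X}) :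
  (forall i, continuous (fun y => f y i)) -> continuous f.
Proof.
move=> fC y; apply/cvg_sup => i; apply/cvg_image => [|U nU].
  by apply/seteqP; split=> // x _; exists (dfwith (f y) i x) => //; rewrite dfwithin.
exists ((fun w : {ptws 'I_k -> X} => w i) @^-1` U); first exact: fC.
apply/seteqP; split=> [x [v /= Uv <-] //|x Ux].
by exists (dfwith (f y) i x) => /=; rewrite dfwithin.
Qed.

Lemma reindex_continuous (X : topologicalType) m k (u : 'I_k -> 'I_m) :
  continuous (fun w : {ptws 'I_m -> X} => (w \o u : {ptws 'I_k -> X})).
Proof. by apply: ptws_continuous => i; exact: coord_continuous. Qed.

End Continuity.

(** * A Borel linear order and increasing enumerations *)

Section LinearOrder.
Variable X : topologicalType.
Hypothesis cX : has_cells X.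

Lemma amap_eq : amap (fun p : X * X => p.1 == p.2).
Proof.
have cE : closed [set p : X * X | p.1 = p.2].
  move=> [x y] /= cl; case: cX => hX _; apply: hX => A B nA nB.
  have [] := cl (A `*` B); first by exists (A, B).
  by move=> [z w] /= [-> [Az Bz]]; exists w.
have := amap_asbool (closed_analytic cE).
rewrite (_ : (fun z => _) = fun p : X * X => p.1 == p.2).
  by apply; apply: (open_analytic (prod_has_cells cX cX)); rewrite openC.
apply/funext => p; apply/asboolP/eqP => //.
Qed.

(** Points are compared lexicographically by the sequence of cells that contain them. Two points in
    the same cells coincide, since by [cells_base] these cells converge to both. *)
Lemma borel_linear_order : exists lt : rel X,
  [/\ irreflexive lt, transitive lt, forall x y, x != y -> lt x y || lt y x &
      amap (fun p : X * X => lt p.1 p.2)].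
Proof.
have [hX [c cc]] := cX.
pose cell q : set X := if unpickle q is Some (n, i) then c n i else set0.
pose code (x : X) q := `[< cell q x >].
pose ltP x y q := (forall p, (p < q)%N -> code x p = code y p) /\ ~~ code x q && code y q.
pose lt x y := `[< exists q, ltP x y q >].
have irr : irreflexive lt.
  by move=> x; apply/negP => /asboolP[q [_ /andP[/negP]]].
have tr : transitive lt.
  move=> y x z /asboolP[q [q1 /andP[qx qy]]] /asboolP[r [r1 /andP[ry rz]]].
  apply/asboolP; have [qr|rq|qr] := ltngtP q r.
  - exists q; split; last by rewrite qx -r1.
    by move=> p pq; rewrite q1 // r1 //; apply: ltn_trans qr.
  - exists r; split; last by rewrite q1 // ry.
    by move=> p pr; rewrite q1 ?r1 //; apply: ltn_trans rq.
  - by move: ry; rewrite -qr qy.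
have tot x y : x != y -> lt x y || lt y x.
  move=> xy; have [q dq] : exists q, code x q != code y q.
    apply: contrapT => nq; case/eqP: xy; apply: hX => A B nA nB.
    have /choice[s sP] := fun n => cells_cover cc n x.
    have ys j : c j (s j) y.
      apply: contrapT => ncy; apply: nq; exists (pickle (j, s j)).
      rewrite /code /cell pickleK.
      by rewrite (asboolT (sP j)) (asboolF ncy).
    exists y; split; last exact: nbhs_singleton.
    by have [n] := cells_base cX.1 cc sP nA; apply.
  case: (ex_minnP (ex_intro (fun q => code x q != code y q) q dq)) => m dm mmin.
  have eqm p : (p < m)%N -> code x p = code y p.
    by move=> pm; apply/eqP; apply: contraTT pm => /mmin; rewrite -leqNgt.
  case E: (code x m); move: dm; rewrite E; case E': (code y m) => // _; apply/orP.
    by right; apply/asboolP; exists m; split; [move=> p /eqm ->|rewrite E E'].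
  by left; apply/asboolP; exists m; split; [|rewrite E E'].
exists lt; split=> //.
have acode q : amap (fun x => code x q).
  apply: amap_asbool.
    rewrite /cell; case: (unpickle q) => [[n i]|]; last exact: analytic0.
    exact/closed_analytic/(cells_closed cc).
  apply: (open_analytic cX); rewrite openC /cell.
  by case: (unpickle q) => [[n i]|]; [exact: (cells_closed cc)|exact: closed0].
have fstC : continuous (fst : X * X -> X) by move=> p; apply: cvg_fst.
have sndC : continuous (snd : X * X -> X) by move=> p; apply: cvg_snd.
have alt : analytic [set p : X * X | lt p.1 p.2].
  have -> : [set p : X * X | lt p.1 p.2] = [set p : X * X | exists q,
    ([set p : X * X | forall i : 'I_q, code p.1 i = code p.2 i] `&`
     [set p : X * X | ~~ code p.1 q && code p.2 q]) p].
    apply/seteqP; split=> p.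
      move=> /asboolP[q [q1 q2]]; exists q; split=> // i; exact: q1.
    move=> [q [q1 q2]]; apply/asboolP; exists q; split=> // i iq.
    exact: (q1 (Ordinal iq)).
  have acode1 q : amap (fun p : X * X => code p.1 q) by exact: amap_subst fstC (acode q).
  have acode2 q : amap (fun p : X * X => code p.2 q) by exact: amap_subst sndC (acode q).
  apply: analytic_ex => q; apply: analyticI.
    apply: analytic_all => i.
    exact: (amap_pred (fun b => b.1 = b.2) (amap_pair (acode1 i) (acode2 i))).
  exact: (amap_pred (fun b => ~~ b.1 && b.2) (amap_pair (acode1 q) (acode2 q))).
have swC : continuous (fun p : X * X => (p.2, p.1)) by exact: pair_continuous.
have := @amap_asbool (X * X)%type [set p | lt p.1 p.2] alt.
rewrite (_ : (fun z => _) = fun p : X * X => lt p.1 p.2); last first.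
  by apply/funext => p; apply/asboolP/idP.
(* By totality the complement is equality or the reversed order, hence analytic as well. *)
apply; have -> : ~` [set p | lt p.1 p.2] =
    [set p : X * X | p.1 == p.2] `|` (fun p => (p.2, p.1)) @^-1` [set p | lt p.1 p.2].
  apply/seteqP; split=> -[x y] /=.
    by move=> /negP nxy; have [->|/tot] := eqVneq x y; [left|rewrite (negPf nxy); right].
  by move=> [/eqP ->|yx]; apply/negP; rewrite ?irr //; apply/negP => xy; move: (tr _ _ _ xy yx); rewrite irr.
apply: analyticU; first exact: (amap_pred (fun b => is_true b) amap_eq).
exact: preimage_analytic alt.
Qed.

End LinearOrder.

Section Enumeration.
Variables (X : choiceType) (lt : rel X).
Hypotheses (lt_irr : irreflexive lt) (lt_trans : transitive lt)
  (lt_total : forall x y, x != y -> lt x y || lt y x).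

(** A finite set has exactly one increasing enumeration, so constructions on ['I_k] transfer to its
    [k]-element subsets without arbitrary choices. *)
Definition increasing k (w : 'I_k -> X) := forall i j : 'I_k, (i < j)%N -> lt (w i) (w j).

Lemma increasing_inj k (w : 'I_k -> X) : increasing w -> injective w.
Proof.
move=> wi i j wij; apply: val_inj; have [ij|ji|//] := ltngtP i j.
  by have := wi _ _ ij; rewrite wij lt_irr.
by have := wi _ _ ji; rewrite wij lt_irr.
Qed.

Let cod k (w : 'I_k -> X) := [seq w i | i <- enum 'I_k].

Lemma mem_cod k (w : 'I_k -> X) x : (x \in cod w) <-> range w x.
Proof.
by split=> [/mapP[i _ ->]|[i _ <-]]; [exists i|apply/map_f; rewrite mem_enum].
Qed.

Lemma sorted_cod k (w : 'I_k -> X) : increasing w -> sorted lt (cod w).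
Proof.
case: k w => [|k] w wi; first by rewrite /cod enum_ord0.
apply: (@homo_sorted _ _ w (fun i j => (i < j)%N)) => [i j|]; first exact: wi.
by have := iota_ltn_sorted 0 k.+1; rewrite -val_enum_ord sorted_map.
Qed.

Lemma increasing_unique k (w w' : 'I_k -> X) :
  increasing w -> increasing w' -> range w = range w' -> w = w'.
Proof.
move=> /sorted_cod sw /sorted_cod sw' ww'.
have : cod w = cod w'.
  apply: (irr_sorted_eq lt_trans lt_irr sw sw') => x.
  by apply/idP/idP => /mem_cod; rewrite ?ww' -?ww' => h; apply/mem_cod; rewrite ?ww' -?ww'.
by move=> /eq_in_map h; apply/funext => i; apply: h; rewrite mem_enum.
Qed.

Lemma finite_increasing (K : set X) : finite_set K ->
  exists k (w : 'I_k -> X), increasing w /\ range w = K.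
Proof.
move=> /finite_seqP[r ->]; pose le x y := (x == y) || lt x y.
pose s := sort le (undup r).
have sK x : x \in s <-> [set` r] x by rewrite mem_sort mem_undup.
have us : uniq s by rewrite sort_uniq undup_uniq.
have srt : sorted le s.
  by apply: sort_sorted => x y; rewrite /le; have [//|/lt_total/orP[->|->]] := eqVneq x y; rewrite ?orbT.
have slt : sorted lt s.
  move: us srt; case: s {sK} => //= x s /andP[]; elim: s x => //= y s IHs x.
  rewrite inE negb_or => /andP[xy xs] /andP[ys us] /andP[].
  by rewrite {1}/le (negPf xy) /= => -> /IHs -> //.
have w0 (i : 'I_(size s)) : {x | x = tnth (in_tuple s) i} by exists (tnth (in_tuple s) i).
exists (size s), (tnth (in_tuple s)); split.
  move=> i j ij; have x0 := tnth (in_tuple s) i; rewrite !(tnth_nth x0) /=.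
  by apply: (sorted_ltn_nth lt_trans x0 slt); rewrite ?inE ?ltn_ord.
apply/seteqP; split=> [x [i _ <-]|x /sK xs].
  by apply/sK; exact: mem_tnth.
by have /tnthP[i ->] : x \in in_tuple s by []; exists i.
Qed.

End Enumeration.

End AnalyticSets.

(** * Regular Borel graphs *)

Section BorelGraphs.
Local Open Scope classical_set_scope.

Section Graph.
Variables (X : ptopologicalType) (G : set (X * X)).
Hypothesis simpleG : simple_graph G.

Let adj_sym : symmetric (adj G).
Proof. by move=> x y; apply/asboolP/asboolP; apply: simpleG.2. Qed.

Lemma adjP x y : reflect (G (x, y)) (adj G x y).
Proof. exact: asboolP. Qed.

Lemma reachable_refl x : reachable G x x.
Proof. by exists [::]. Qed.

Lemma reachable_edge x y : G (x, y) -> reachable G x y.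
Proof. by move=> xy; exists [:: y] => //=; rewrite andbT; apply/asboolP. Qed.

Lemma reachable_trans y x z : reachable G x y -> reachable G y z -> reachable G x z.
Proof.
move=> [p px <-] [q qy <-]; exists (p ++ q); last by rewrite last_cat.
by rewrite cat_path px.
Qed.

Lemma reachable_sym x y : reachable G x y -> reachable G y x.
Proof.
move=> [p px <-]; exists (rev (belast x p)).
  by rewrite rev_path; under eq_path do rewrite adj_sym.
by case: p px => //= a p _; rewrite rev_cons last_rcons.
Qed.

Lemma component_eq x y : reachable G x y -> component G x = component G y.
Proof.
move=> xy; apply/seteqP; split=> z; last exact: reachable_trans.
by apply: reachable_trans; apply: reachable_sym.
Qed.

Lemma not_uniq_split (s : seq X) : ~~ uniq s ->
  exists y s1 s2 s3, s = s1 ++ y :: s2 ++ y :: s3.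
Proof.
elim: s => //= a s IHs; rewrite negb_and negbK => /orP[as_|/IHs[y [s1 [s2 [s3 ->]]]]].
  by case/splitPr: as_ => s1 s2; exists a, [::], s1, s2.
by exists y, (a :: s1), s2, s3.
Qed.

(** A repeated vertex cuts the walk into two shorter closed walks. Without repetition it is a cycle
    or has length at most 2, and length 1 would be a loop. *)
Lemma closed_walk_even x p : bipartite G ->
  path (adj G) x p -> last x p = x -> ~~ odd (size p).
Proof.
move=> bip; have [n] := ubnP (size p); elim: n p x => // n IHn p x ltpn px lx.
have [up|/not_uniq_split[y [s1 [s2 [s3 pE]]]]] := boolP (uniq p).
  case: p up ltpn px lx => //= y q uq _ /andP[xy yq] lx.
  case: q uq yq lx => [_ _ /= yx|z q uq yq lx].
    by move: xy; rewrite yx => /asboolP/(simpleG.1).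
  case: q uq yq lx => [//|u q] uq yq lx.
  apply: (bip [:: y, z, u & q]); split=> //; apply/andP; split=> //.
  by rewrite /cycle rcons_path yq lx.
move: px lx ltpn; rewrite {p}pE !cat_path last_cat /= !cat_path !last_cat /=.
move=> /and3P[p1 e1 /and3P[p2 e2 p3]] l3.
rewrite !size_cat /= size_cat /= => ltn.
have := IHn (rcons s2 y) y; rewrite rcons_path p2 e2 last_rcons size_rcons.
have := IHn (s1 ++ y :: s3) x; rewrite cat_path last_cat /= p1 e1 p3 size_cat /=.
move=> /(_ _ isT l3) h1 /(_ _ isT erefl) h2.
by have := h1 _; have := h2 _; lia.
Qed.

(** The colour is the parity of the walks from a chosen root of the component, well defined by
    [closed_walk_even]. Nothing makes it Borel. *)
Lemma bipartite_colouring : bipartite G ->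
  exists c : X -> bool, forall x y, G (x, y) -> c x != c y.
Proof.
(* [get] is applied to the component as a set, so all its vertices share one root. *)
move=> bip; pose r x := get (component G x).
have rP x : reachable G x (r x).
  apply: (xgetPex point (P := component G x)).
  by exists x; exact: reachable_refl.
pose odd_walk x := exists p, [/\ path (adj G) (r x) p, last (r x) p = x & odd (size p)].
exists (fun x => `[< odd_walk x >]) => x y xy.
have rE : r y = r x by rewrite /r (component_eq (reachable_edge xy)).
have step u v : r u = r v -> G (u, v) -> odd_walk u -> ~ odd_walk v.
  move=> ruv uv [p [pu pl po]] [q [qv ql qo]].
  have [q' q'v q'l] : exists2 q', path (adj G) v q' & last v q' = r u /\ size q' = size q.
    exists (rev (belast (r v) q)); last split.
    - by rewrite -{1}ql rev_path; under eq_path do rewrite adj_sym.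
    - rewrite ruv; case: (q) ql => [/= ->//|a s] /= _.
      by rewrite rev_cons last_rcons.
    - by rewrite size_rev size_belast.
  have := @closed_walk_even (r u) (p ++ v :: q') bip.
  rewrite cat_path pu pl /= q'v andbT last_cat /= q'l.1 size_cat /= q'l.2 oddD po /= qo.
  by move=> /(_ (asboolT uv) erefl).
have walk u : exists p, path (adj G) (r u) p /\ last (r u) p = u.
  by have [p] := reachable_sym (rP u); exists p.
have even_step u v : r u = r v -> G (u, v) -> ~ odd_walk u -> odd_walk v.
  move=> ruv uv nu; have [p [pu pl]] := walk u.
  exists (rcons p v); rewrite -ruv rcons_path pu pl last_rcons size_rcons; split=> //.
    exact/asboolP.
  by apply/negP => po; apply: nu; exists p.
apply/negP => /eqP; have [ox|nox] := pselect (odd_walk x).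
  by rewrite (asboolT ox) (asboolF (step x y (esym rE) xy ox)).
by rewrite (asboolF nox) (asboolT (even_step x y (esym rE) xy nox)).
Qed.

(** * Definability of neighbour sums and of finite components *)

Section Neighbours.
Variables (d : nat) (nb : X -> seq X).
Hypotheses (nb_uniq : forall x, uniq (nb x)) (size_nb : forall x, size (nb x) = d)
  (mem_nb : forall x y, (y \in nb x) = adj G x y).

Lemma nb_ffun x : exists2 w : 'I_d -> X, injective w &
  (forall i, G (x, w i)) /\ perm_eq (nb x) [seq w i | i <- enum 'I_d].
Proof.
have x0 : X := point.
exists (fun i => nth point (nb x) i); last split.
- move=> i j /eqP; rewrite nth_uniq ?size_nb ?ltn_ord //; exact: (fun e => val_inj (eqP e)).
- move=> i; have := mem_nth point (_ : (i < size (nb x))%N).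
  by rewrite size_nb ltn_ord mem_nb => /(_ isT) /asboolP.
- rewrite -[X in perm_eq X](mkseq_nth point) size_nb /mkseq -val_enum_ord -map_comp.
  exact: perm_refl.
Qed.

Lemma nb_perm x (w : 'I_d -> X) : injective w -> (forall i, G (x, w i)) ->
  perm_eq (nb x) [seq w i | i <- enum 'I_d].
Proof.
move=> wi wG; have us : uniq [seq w i | i <- enum 'I_d] by rewrite map_inj_uniq ?enum_uniq.
have sub : {subset [seq w i | i <- enum 'I_d] <= nb x}.
  by move=> _ /mapP[i _ ->]; rewrite mem_nb; apply/asboolP.
rewrite perm_sym; apply: uniq_perm => //.
by have [] := uniq_min_size us sub; rewrite size_map size_enum_ord size_nb.
Qed.

Definition nsum (h : X -> int) x := (\sum_(y <- nb x) h y)%R.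

(** The bridge between sums over neighbours in [X] and sums over an enumerated finite set: each side
    omits only zero terms of the other. *)
Lemma nsum_range k (w : 'I_k -> X) (h : X -> int) x : injective w ->
    (forall y, G (x, y) -> h y != 0%R -> range w y) ->
    (forall i, h (w i) != 0%R -> G (x, w i)) ->
  nsum h x = (\sum_i h (w i))%R.
Proof.
move=> wi hw hG; pose s := [seq w i | i <- enum 'I_k].
have us : uniq s by rewrite map_inj_uniq ?enum_uniq.
have ms y : range w y -> y \in s by move=> [i _ <-]; rewrite map_f ?mem_enum.
have -> : (\sum_i h (w i) = \sum_(y <- s) h y)%R.
  by rewrite big_map big_enum.
have -> : (\sum_(y <- s) h y = \sum_(y <- s | y \in nb x) h y)%R.
  rewrite [LHS](bigID (mem (nb x))) /= [X in (_ + X)%R]big_seq_cond.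
  rewrite [X in (_ + X)%R]big1 ?addr0 // => y /andP[/mapP[i _ ->]].
  by rewrite mem_nb => /asboolP nG; apply/eqP; apply: contrapT => /negP /hG.
rewrite /nsum [LHS](bigID (mem s)) /= [X in (_ + X)%R]big_seq_cond.
rewrite [X in (_ + X)%R]big1 ?addr0 => [|y /andP[]]; last first.
  rewrite mem_nb => /asboolP Gy ys; apply/eqP; apply: contraNT ys => hy.
  exact/ms/hw.
rewrite -[LHS]big_filter -[RHS]big_filter; apply: perm_big; apply: uniq_perm; rewrite ?filter_uniq //.
by move=> y; rewrite !mem_filter andbC.
Qed.

Lemma nsumD h k x : (nsum (fun y => h y + k y) x = nsum h x + nsum k x)%R.
Proof. exact: big_split. Qed.

Hypotheses (cX : has_cells X) (borelG : borel_set G).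

Let cW k : has_cells {ptws 'I_k -> X} := ffun_has_cells k cX.

Lemma amap_adj : amap (fun p : X * X => adj G p.1 p.2).
Proof.
have := borel_amap (prod_has_cells cX cX) borelG.
by rewrite (_ : (fun z => _) = fun p : X * X => adj G p.1 p.2) //; apply/funext => -[].
Qed.

Lemma amap_adj2 (Z : topologicalType) (f g : Z -> X) :
  continuous f -> continuous g -> amap (fun z => adj G (f z) (g z)).
Proof. by move=> fC gC; apply: (amap_subst (pair_continuous fC gC) amap_adj). Qed.

Lemma amap_eq2 (Z : topologicalType) (f g : Z -> X) :
  continuous f -> continuous g -> amap (fun z => f z == g z).
Proof. by move=> fC gC; apply: (amap_subst (pair_continuous fC gC) (amap_eq cX)). Qed.

Lemma amap_injective k : amap (fun w : {ptws 'I_k -> X} => `[< injective w >]).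
Proof.
have -> : (fun w : {ptws 'I_k -> X} => `[< injective w >]) =
    fun w => [forall i, [forall j, (w i == w j) ==> (i == j)]].
  apply/funext => w; apply/asboolP/forallP => [wi i|wP i j wij].
    by apply/forallP => j; apply/implyP => /eqP/wi ->.
  by have := wP i; move=> /forallP/(_ j)/implyP; rewrite wij eqxx => /(_ isT)/eqP.
apply: amap_all => i; apply: amap_all => j.
apply: (amap_comp (fun b => b ==> (i == j))).
by apply: amap_eq2; apply: coord_continuous.
Qed.

(** The lists [nb] are arbitrary choices, but the sum depends only on the set of neighbours: any
    injective [d]-tuple of neighbours witnesses its value, and projections keep analyticity. *)
Lemma amap_nsum (h : X -> X -> int) :
  amap (fun p : X * X => h p.1 p.2) -> amap (fun x => nsum (h x) x).
Proof.
move=> ah v; pose P (z : X * {ptws 'I_d -> X}) := [&& `[< injective z.2 >],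
  [forall i, adj G z.1 (z.2 i)] & (\sum_i h z.1 (z.2 i))%R == v].
have -> : [set x | nsum (h x) x = v] = [set x | exists w, [set z | P z] (x, w)].
  apply/seteqP; split=> [x /= hx|x [w /= /and3P[/asboolP wi /forallP wG /eqP <-]]].
    have [w wi [wG wp]] := nb_ffun x; exists w; apply/and3P; split.
    - exact/asboolP.
    - by apply/forallP => i; apply/asboolP.
    - by rewrite -hx /nsum (perm_big _ wp) /= big_map big_enum.
  have wG' i : G (x, w i) by apply/asboolP/wG.
  by rewrite /nsum (perm_big _ (nb_perm wi wG')) /= big_map big_enum.
have fstC : continuous (fst : X * {ptws 'I_d -> X} -> X) by move=> p; apply: cvg_fst.
have sndC : continuous (snd : X * {ptws 'I_d -> X} -> _) by move=> p; apply: cvg_snd.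
have iC i : continuous (fun z : X * {ptws 'I_d -> X} => z.2 i).
  exact: continuous_comp2 sndC (@coord_continuous _ _ i).
apply: (exists_analytic (cW _)); apply: amap_bool.
apply: amap_comp2; first exact: amap_subst sndC (@amap_injective d).
apply: amap_comp2; first by apply: amap_all => i; apply: amap_adj2.
apply: (amap_comp (fun b => b == v)); apply: amap_sum => i.
exact: (amap_subst (pair_continuous fstC (iC i)) ah).
Qed.

Definition adj_matrix k (w : 'I_k -> X) : {ffun 'I_k * 'I_k -> bool} :=
  [ffun p => adj G (w p.1) (w p.2)].

Lemma amap_adj_matrix k : amap (fun w : {ptws 'I_k -> X} => adj_matrix w).
Proof.
apply: amap_ffun => -[i j]; apply: amap_adj2; exact: coord_continuous.
Qed.

Definition full_matrix k (A : {ffun 'I_k * 'I_k -> bool}) :=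
  [forall i, #|[pred j | A (i, j)]| == d].

(** As all degrees are [d], a row with [d] ones leaves no neighbour outside: closure under adjacency
    is read off a finite matrix. *)
Lemma full_matrixP k (w : 'I_k -> X) : injective w ->
  full_matrix (adj_matrix w) <-> forall i y, G (w i, y) -> range w y.
Proof.
move=> wi; pose s := [seq w i | i <- enum 'I_k].
have us : uniq s by rewrite map_inj_uniq ?enum_uniq.
have ms y : (y \in s) <-> range w y.
  by split=> [/mapP[i _ ->]|[i _ <-]]; [exists i|rewrite map_f ?mem_enum].
have card_row i : #|[pred j | adj_matrix w (i, j)]| = count (mem s) (nb (w i)).
  rewrite cardE -(size_map w) -(size_filter (mem s)); apply/perm_size/uniq_perm.
  - by rewrite map_inj_uniq ?enum_uniq.
  - exact: filter_uniq.
  move=> y; rewrite mem_filter mem_nb; apply/mapP/andP => [[j]|[/ms[j _ <-] Gj]].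
    by rewrite mem_enum inE ffunE /= => Gj ->; split=> //; apply/ms; exists j.
  by exists j => //; rewrite mem_enum inE ffunE.
split=> [/forallP fA i y Gy|cl].
  have := fA i; rewrite card_row -(size_nb (w i)) -all_count => /allP/(_ y).
  by rewrite mem_nb => /(_ (asboolT Gy)) /ms.
apply/forallP => i; rewrite card_row -(size_nb (w i)) -all_count.
by apply/allP => y; rewrite mem_nb => /asboolP/cl/ms.
Qed.

Lemma reachable_analytic : analytic [set p : X * X | reachable G p.1 p.2].
Proof.
pose P m (z : (X * X) * {ptws 'I_m.+1 -> X}) := [&& z.2 ord0 == z.1.1,
  z.2 ord_max == z.1.2 & [forall i : 'I_m, adj G (z.2 (widen_ord (leqnSn m) i)) (z.2 (lift ord0 i))]].
have -> : [set p : X * X | reachable G p.1 p.2] =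
    [set p | exists m, [set p | exists w, [set z | P m z] (p, w)] p].
  apply/seteqP; split=> [[x y] /= [p px pl]|[x y] [m [w /and3P[/= /eqP <- /eqP <- /forallP wG]]]].
    exists (size p), (fun i => nth x (x :: p) i); apply/and3P; split=> //=.
      by rewrite -pl (last_nth x).
    by apply/forallP => i /=; have /pathP := px; move=> /(_ x i (ltn_ord i)).
  exists [seq w (lift ord0 i) | i <- enum 'I_m].
    apply/(pathP (w ord0)) => i; rewrite size_map size_enum_ord => im.
    have := wG (Ordinal im); congr (adj G _ _).
      case: i im => [|i] im /=; first by congr w; apply: val_inj.
      rewrite (nth_map (Ordinal im)) ?size_enum_ord ?(ltnW im) //.
      by congr w; apply: val_inj; rewrite /= nth_enum_ord // ltnW.
    rewrite (nth_map (Ordinal im)) ?size_enum_ord //.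
    by congr w; apply: val_inj; rewrite /= nth_enum_ord.
  rewrite (last_nth (w ord0)) size_map size_enum_ord; case: m w {wG} => [|m] w /=.
    by congr w; apply: val_inj.
  rewrite (nth_map ord_max) ?size_enum_ord //.
  by congr w; apply: val_inj; rewrite /= nth_enum_ord.
apply: analytic_ex => m; apply: (exists_analytic (cW _)).
apply: amap_bool.
have fC : continuous (fun z : (X * X) * {ptws 'I_m.+1 -> X} => z.1) by move=> p; apply: cvg_fst.
have sC : continuous (fun z : (X * X) * {ptws 'I_m.+1 -> X} => z.2) by move=> p; apply: cvg_snd.
have f1C : continuous (fst : X * X -> X) by move=> p; apply: cvg_fst.
have s1C : continuous (snd : X * X -> X) by move=> p; apply: cvg_snd.
have iC i := continuous_comp2 sC (@coord_continuous X m.+1 i).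
apply: amap_comp2; first exact: amap_eq2 (continuous_comp2 fC f1C).
apply: amap_comp2; first exact: amap_eq2 (continuous_comp2 fC s1C).
by apply: amap_all => i; apply: amap_adj2.
Qed.

Definition fin_comp x := finite_set (component G x).

Lemma full_component k (w : 'I_k -> X) i : injective w -> full_matrix (adj_matrix w) ->
  component G (w i) `<=` range w.
Proof.
move=> wi /(full_matrixP wi) cl y [p]; elim: p i => [|z p IHp] i /= => [_ <-|].
  by exists i.
move=> /andP[/asboolP /cl [j _ <-]]; exact: IHp.
Qed.

Lemma fin_comp_edge x y : G (x, y) -> fin_comp x -> fin_comp y.
Proof. by move=> xy; rewrite /fin_comp (component_eq (reachable_edge xy)). Qed.

Lemma finite_comp_full x : fin_comp x -> exists k (w : 'I_k -> X),
  [/\ injective w, full_matrix (adj_matrix w) & range w = component G x].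
Proof.
move=> /finite_seqP[r rE]; pose s := undup r.
have sE : component G x = [set` s] by rewrite rE; apply/seteqP; split=> y /=; rewrite mem_undup.
have us : uniq s by exact: undup_uniq.
pose w (i : 'I_(size s)) := tnth (in_tuple s) i.
have rw : range w = component G x.
  rewrite sE; apply/seteqP; split=> [y [i _ <-]|y /= ys]; first exact: mem_tnth.
  by have /tnthP[i ->] : y \in in_tuple s by []; exists i.
have wi : injective w.
  by move=> i j /eqP; rewrite /w !(tnth_nth x) nth_uniq // => /eqP/val_inj.
exists (size s), w; split=> //; apply/full_matrixP => // i y Gy.
rewrite rw; have : component G x (w i) by rewrite -rw; exists i.
by move=> /reachable_trans; apply; apply: reachable_edge.
Qed.

(** Both sides are analytic: finiteness is witnessed by a finite set through [x] closed under
    adjacency, infinity by [n] distinct reachable points for every [n]. *)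
Lemma amap_fin_comp : amap (fun x => `[< fin_comp x >]).
Proof.
pose A := [set x | exists k, [set x | exists w : {ptws 'I_k -> X}, [set z : X * {ptws 'I_k -> X} |
  [&& `[< injective z.2 >], [exists i, z.2 i == z.1] & full_matrix (adj_matrix z.2)]] (x, w)] x].
have AE : [set x | fin_comp x] = A.
  apply/seteqP; split=> [x /finite_comp_full[k [w [wi wf wE]]]|
      x [k [w /= /and3P[/asboolP wi /existsP[i /eqP <-] wf]]]].
    have [i _ wix] : range w x by rewrite wE; exact: reachable_refl.
    exists k, w; apply/and3P; split=> //=; first exact/asboolP.
    by apply/existsP; exists i; apply/eqP.
  rewrite /= /fin_comp; have sub := @full_component _ _ i wi wf.
  apply: (sub_finite_set sub).
  by apply: finite_image; exact: finite_finset.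
pose D := [set x | forall n, [set x | exists w : {ptws 'I_n -> X},
  [set z : X * {ptws 'I_n -> X} | injective z.2 /\ forall i, reachable G z.1 (z.2 i)] (x, w)] x].
have DE : ~` [set x | fin_comp x] = D.
  apply/seteqP; split=> [x nf n|x xD].
    have [s [us ss sc]] : exists s : seq X, [/\ uniq s, size s = n & forall y, y \in s -> component G x y].
      elim: n => [|n [s [us ss sc]]]; first by exists [::].
      have [y ys yc] : exists2 y, y \notin s & component G x y.
        apply: contrapT => ny; apply: nf; apply: sub_finite_set (finite_seq s) => y yc.
        by apply: contrapT => /negP ys; apply: ny; exists y.
      exists (y :: s); split; rewrite /= ?ys ?ss // => z.
      by rewrite inE => /orP[/eqP ->//|]; exact: sc.
    exists (fun i => nth x s i); split=> [i j /= /eqP|i /=].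
      by rewrite nth_uniq ?ss ?ltn_ord // => /eqP/val_inj.
    by apply: sc; rewrite mem_nth ?ss ?ltn_ord.
  move=> /finite_seqP[s sE]; have [w [/= wi wc]] := xD (size s).+1.
  have u : uniq [seq w i | i <- enum 'I_(size s).+1] by rewrite map_inj_uniq ?enum_uniq.
  have := uniq_leq_size u (s2 := s); rewrite size_map size_enum_ord ltnn.
  suff sub : {subset [seq w i | i <- enum 'I_(size s).+1] <= s} by move=> /(_ sub).
  move=> _ /mapP[i _ ->]; have : component G x (w i) by exact: wc.
  by rewrite sE.
apply: (amap_asbool (P := [set x | fin_comp x])).
  rewrite AE; apply: analytic_ex => k; apply: (exists_analytic (cW _)).
  have sC : continuous (snd : X * {ptws 'I_k -> X} -> _) by move=> p; apply: cvg_snd.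
  have fC : continuous (fst : X * {ptws 'I_k -> X} -> _) by move=> p; apply: cvg_fst.
  apply: amap_bool.
  apply: amap_comp2; first exact: amap_subst sC (@amap_injective k).
  apply: amap_comp2.
    by apply: amap_exists => i; apply: amap_eq2 => //;
      exact: continuous_comp2 sC (@coord_continuous X k i).
  exact: (amap_comp _ (amap_subst sC (@amap_adj_matrix k))).
rewrite DE; apply: analytic_all => n; apply: (exists_analytic (cW _)).
have sC : continuous (snd : X * {ptws 'I_n -> X} -> _) by move=> p; apply: cvg_snd.
have fC : continuous (fst : X * {ptws 'I_n -> X} -> _) by move=> p; apply: cvg_fst.
apply: analyticI.
  have := amap_pred (fun b => is_true b) (amap_subst sC (@amap_injective n)).
  rewrite (_ : mkset _ = [set z : X * {ptws 'I_n -> X} | injective z.2]) //.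
  by apply/seteqP; split=> z /asboolP.
apply: analytic_all => i.
have iC := continuous_comp2 sC (@coord_continuous X n i).
exact: (preimage_analytic (pair_continuous fC iC) reachable_analytic).
Qed.

End Neighbours.

Lemma neighbours_exist d : regular d G -> exists nb : X -> seq X,
  [/\ forall x, uniq (nb x), forall x, size (nb x) = d & forall x y, (y \in nb x) = adj G x y].
Proof.
move=> reg; have /choice[nb nbP] x : exists s : seq X,
    [/\ uniq s, size s = d & forall y, (y \in s) = adj G x y].
  have := reg x; rewrite card_eq_sym => /card_set_bijP[f [fA fI fS]].
  exists [seq f i | i <- iota 0 d]; split.
  - rewrite map_inj_in_uniq ?iota_uniq // => i j; rewrite !mem_iota /= !add0n => id jd.
    by apply: fI; rewrite inE.
  - by rewrite size_map size_iota.
  move=> y; apply/mapP/asboolP => [[i]|Gy].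
    by rewrite mem_iota /= add0n => id ->; apply: fA.
  by have [i id <-] := fS _ Gy; exists i; rewrite // mem_iota.
by exists nb; split=> x; have [] := nbP x.
Qed.

End Graph.

End BorelGraphs.

(** * Processing one level of the toast *)

Section Toasts.
Local Open Scope ring_scope.
Local Open Scope classical_set_scope.

Lemma range_subset_card (T : eqType) k m (w : 'I_k -> T) (w' : 'I_m -> T) :
  injective w -> range w `<=` range w' ->
  (k <= m)%N /\ ((m <= k)%N -> range w' `<=` range w).
Proof.
move=> wi ww'; pose s := [seq w i | i <- enum 'I_k]; pose s' := [seq w' i | i <- enum 'I_m].
have us : uniq s by rewrite map_inj_uniq ?enum_uniq.
have sub : {subset s <= s'}.
  move=> _ /mapP[i _ ->]; have [|j _ <-] := ww' (w i); first by exists i.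
  by rewrite map_f ?mem_enum.
have sz : size s = k by rewrite size_map size_enum_ord.
have sz' : size s' = m by rewrite size_map size_enum_ord.
split=> [|mk _ [j _ <-]]; first by rewrite -sz -sz'; apply: uniq_leq_size.
have [|_ ss'] := uniq_min_size us sub; first by rewrite sz sz'.
have : w' j \in s' by rewrite map_f ?mem_enum.
by rewrite -ss' => /mapP[i _ ->]; exists i.
Qed.

Section Toast.
Variables (X : ptopologicalType) (G : set (X * X)) (T : set (set X)).
Hypotheses (simpleG : simple_graph G) (toastT : connected_toast G T).
Variables (d : nat) (nb : X -> seq X).
Hypotheses (nb_uniq : forall x, uniq (nb x)) (size_nb : forall x, size (nb x) = d)
  (mem_nb : forall x y, (y \in nb x) = adj G x y).
Variable lt : rel X.
Hypotheses (lt_irr : irreflexive lt) (lt_trans : transitive lt)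
  (lt_total : forall x y, x != y -> lt x y || lt y x).

Local Notation fin := (fin_comp G).

Lemma toast_finite K : T K -> finite_set K.
Proof. by case: toastT => -[[h _] _ _] _; apply: h. Qed.

Lemma subset_B1 K : K `<=` B1 G K.
Proof. by move=> x Kx; exists x => //; left. Qed.

Lemma toast_edge x y : G (x, y) -> exists K, [/\ T K, K x & K y].
Proof.
case: toastT => -[_ h _] _; rewrite -{1}h => -[K TK [_ [/= Kx Ky]]].
by exists K.
Qed.

Lemma toast_nested K L x : T K -> T L -> K <> L -> K x -> L x ->
  B1 G K `<=` L \/ B1 G L `<=` K.
Proof.
case: toastT => -[_ _ h] _ TK TL KL Kx Lx; have [e|s|s] := h _ _ TK TL KL.
- suff : (B1 G K `&` L) x by rewrite e.
  by split => //; exact: subset_B1.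
- by left.
- by right.
Qed.

Lemma toast_proper K L : T K -> T L -> L `<` K -> B1 G L `<=` K.
Proof.
move=> TK TL LK; have [->|/set0P[x Lx]] := eqVneq L set0.
  by move=> x [].
have KL : K <> L by move=> e; move: LK; rewrite e => /properxx.
have [|//] := toast_nested TK TL KL (properW LK Lx) Lx.
by move=> s; case: KL; apply/seteqP; split; [exact: subset_trans (@subset_B1 K) s|exact: properW].
Qed.

Definition enumerates k (w : 'I_k -> X) := increasing lt w /\ T (range w).

Lemma enumerates_inj k (w : 'I_k -> X) : enumerates w -> injective w.
Proof. by case=> /increasing_inj wi _; apply: wi. Qed.

Lemma toast_enumerates K : T K -> exists k (w : 'I_k -> X), enumerates w /\ range w = K.
Proof.
move=> TK; have [k [w [wi wK]]] := finite_increasing lt_trans lt_total (toast_finite TK).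
by exists k, w; split=> //; split=> //; rewrite wK.
Qed.

Lemma enumerates_subset k m (w : 'I_k -> X) (w' : 'I_m -> X) x :
    enumerates w -> enumerates w' -> range w x -> range w' x -> (k <= m)%N ->
  range w `<=` range w'.
Proof.
move=> ew ew' wx w'x km; have [->//|/eqP ne] := eqVneq (range w) (range w').
have [s|s] := toast_nested ew.2 ew'.2 ne wx w'x.
  exact: subset_trans (@subset_B1 _) s.
have s' : range w' `<=` range w by exact: subset_trans (@subset_B1 _) s.
by have [_] := range_subset_card (enumerates_inj ew') s'; apply.
Qed.

(** Toast sets with a common point are nested, so those of equal size coincide. The pieces of one
    stage are thus disjoint and can be treated simultaneously. *)
Lemma enumerates_unique k (w w' : 'I_k -> X) x :
  enumerates w -> enumerates w' -> range w x -> range w' x -> w = w'.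
Proof.
move=> ew ew' wx w'x; apply: (increasing_unique lt_irr lt_trans ew.1 ew'.1).
by apply/seteqP; split; apply: enumerates_subset => //; [exact: wx| |exact: w'x|].
Qed.

Lemma exit_edge L x p : L x -> path (adj G) x p -> ~ L (last x p) ->
  exists a b, [/\ L a, ~ L b & G (a, b)].
Proof.
elim: p x => //= y p IHp x Lx /andP[/asboolP xy yp] nL.
have [Ly|nLy] := pselect (L y); first exact: IHp yp nL.
by exists x, y.
Qed.

(** Some edge leaves [L], because the component is infinite. A toast set containing this edge meets
    [L] and is not inside it, so it contains [L] strictly. *)
Lemma toast_larger L x : ~ fin x -> T L -> L x -> exists2 K, T K & L `<` K.
Proof.
move=> nfx TL Lx; have [z [p px pz] nLz] : exists2 z, component G x z & ~ L z.
  apply: contrapT => nz; apply: nfx; apply: sub_finite_set (toast_finite TL) => z xz.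
  by apply: contrapT => nL; apply: nz; exists z.
have [|a [b [La nLb ab]]] := exit_edge Lx px; first by rewrite pz.
have [K [TK Ka Kb]] := toast_edge ab; exists K => //.
have LK : L <> K by move=> e; apply: nLb; rewrite e.
have [s|s] := toast_nested TL TK LK La Ka.
  split; first exact: subset_trans (@subset_B1 _) s.
  by move=> KL; apply: nLb; apply: KL.
by case: nLb; apply: s; apply: subset_B1.
Qed.

Lemma proper_range_card k m (w : 'I_k -> X) (w' : 'I_m -> X) : injective w ->
  range w `<` range w' -> (k < m)%N.
Proof.
move=> wi [sub nsub]; have [km h] := range_subset_card wi sub.
by rewrite ltn_neqAle km andbT; apply/eqP => e; apply: nsub; apply: h; rewrite e.
Qed.

(** Provides the infinitely many stages at which an edge inside [L] is tested. *)
Lemma toast_unbounded L x n : ~ fin x -> T L -> L x ->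
  exists m (w : 'I_m -> X), [/\ enumerates w, (n < m)%N & L `<` range w].
Proof.
move=> nfx TL Lx; elim: n => [|n [m [w [ew nm Lw]]]].
  have [K TK LK] := toast_larger nfx TL Lx.
  have [m [w [ew wK]]] := toast_enumerates TK; exists m, w; split=> //; last by rewrite wK.
  have [i _ _] : range w x by rewrite wK; apply: (properW LK).
  exact: leq_ltn_trans (leq0n i) (ltn_ord i).
have [K TK wKK] := toast_larger nfx ew.2 (properW Lw Lx).
have [m' [w' [ew' w'K]]] := toast_enumerates TK; exists m', w'; rewrite w'K; split=> //.
  apply: leq_ltn_trans nm _; apply: (@proper_range_card _ _ w w' (enumerates_inj ew)).
  by rewrite w'K.
split; first exact: subset_trans (properW Lw) (properW wKK).
by move=> KL; apply: wKK.2; apply: subset_trans KL (properW Lw).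
Qed.

Definition value_matrix (f : X -> X -> int) k (w : 'I_k -> X) : {ffun 'I_k * 'I_k -> int} :=
  [ffun p => f (w p.1) (w p.2)].

Definition covered k x y := exists w : 'I_k -> X, [/\ enumerates w, range w x & range w y].

Definition seed k := ({ffun 'I_k * 'I_k -> bool} * bool)%type.

(** The piece and the two indices are determined by [x] and [y], so the choice by [cid] is
    immaterial; see [shift_in]. *)
Definition shift f k (sd : seed k) x y : int :=
  if pselect (exists p : ('I_k -> X) * 'I_k * 'I_k,
      [/\ enumerates p.1.1, p.1.1 p.1.2 = x & p.1.1 p.2 = y]) is left e
  then let p := projT1 (cid e) in perturbation d (value_matrix f p.1.1) sd p.1.2 p.2
  else 0%R.

Lemma shift_in f k sd (w : 'I_k -> X) i j : enumerates w ->
  shift f sd (w i) (w j) = perturbation d (value_matrix f w) sd i j.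
Proof.
move=> ew; rewrite /shift; case: pselect => [e|[]]; last by exists (w, i, j).
case: (projT2 (cid e)) => [ew' wi wj].
move: (projT1 (cid e)) ew' wi wj => [[w' i'] j'] /= ew' wi wj.
have ww' : w' = w.
  by apply: (enumerates_unique ew' ew (x := w i)); [exists i'|exists i].
by rewrite ww' in wi wj *; rewrite (enumerates_inj ew wi) (enumerates_inj ew wj).
Qed.

Lemma shift_out f k (sd : seed k) x y : ~ covered k x y -> shift f sd x y = 0%R.
Proof.
move=> nc; rewrite /shift; case: pselect => // -[[[w i] j] /= [ew wi wj]].
by case: nc; exists w; split=> //; [exists i|exists j].
Qed.

Lemma shift_cases f k (sd : seed k) x y : shift f sd x y = 0%R \/
  exists (w : 'I_k -> X) i j, [/\ enumerates w, x = w i & y = w j].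
Proof.
have [[w [ew [i _ <-] [j _ <-]]]|nc] := pselect (covered k x y).
  by right; exists w, i, j.
by left; apply: shift_out.
Qed.

Definition update f k (sd : seed k) x y : int := (f x y + shift f sd x y)%R.

Definition energy (f : X -> X -> int) x := nsum nb (fun y => f x y ^+ 2)%R x.

(* [f x y / d] is a fractional perfect matching, integral on the finite
   components, and equal to [1 / d] on the edges of the infinite components
   that have not been reached before stage [k]. *)
Record invariant k (f : X -> X -> int) : Prop := Invariant {
  inv_sym : forall x y, f x y = f y x;
  inv_supp : forall x y, f x y != 0%R -> G (x, y);
  inv_itv : forall x y, (0 <= f x y <= d%:Z)%R;
  inv_sum : forall x, nsum nb (f x) x = d%:Z;
  inv_amap : amap (fun p : X * X => f p.1 p.2);
  inv_fin : forall x y, fin x -> f x y = 0%R \/ f x y = d%:Z;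
  inv_init : forall x y, ~ fin x -> G (x, y) ->
    (forall j, (j < k)%N -> ~ covered j x y) -> f x y = 1%R }.

(** * One stage: preserved properties and gain in energy *)

Section Update.
Variables (k : nat) (f : X -> X -> int).
Hypothesis invf : invariant k f.
Implicit Type sd : seed k.

(** This is why values stay between 0 and [d], and never change again once they are 0 or [d]. *)
Lemma shift_abs sd x y : (`|shift f sd x y| <= (0 < f x y < d%:Z)%R)%N.
Proof.
have [->//|[w [i [j [ew -> ->]]]]] := shift_cases f sd x y.
rewrite shift_in //; apply: leq_trans (perturbation_abs _ _ _ _ _) _.
by rewrite /fractional ffunE.
Qed.

Lemma update_integral sd x y : f x y = 0%R \/ f x y = d%:Z -> update f sd x y = f x y.
Proof. by rewrite /update; have := shift_abs sd x y; lia. Qed.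

Lemma update_sym sd x y : update f sd x y = update f sd y x.
Proof.
rewrite /update (inv_sym invf); congr (_ + _)%R.
have [[w [ew [i _ <-] [j _ <-]]]|nc] := pselect (covered k x y).
  by rewrite !shift_in // perturbation_sym.
rewrite !shift_out // => -[w [ew wy wx]]; apply: nc; by exists w.
Qed.

Lemma update_itv sd x y : (0 <= update f sd x y <= d%:Z)%R.
Proof. by rewrite /update; have := shift_abs sd x y; have := inv_itv invf x y; lia. Qed.

Lemma update_supp sd x y : update f sd x y != 0%R -> G (x, y).
Proof.
move=> u0; apply: (inv_supp invf); apply: contra_neq u0 => f0.
by rewrite (update_integral sd (or_introl f0)).
Qed.

Lemma nsum_shift sd x : nsum nb (shift f sd x) x = 0%R.
Proof.
have [[w [ew [i _ <-]]]|nw] := pselect (exists w : 'I_k -> X, enumerates w /\ range w x).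
  rewrite (nsum_range nb_uniq mem_nb (enumerates_inj ew)).
  - by rewrite (eq_bigr _ (fun j _ => shift_in f sd i j ew)) perturbation_sum.
  - move=> y _ sy; have [e|[w' [i' [j' [ew' wi' ->]]]]] := shift_cases f sd (w i) y.
      by rewrite e in sy.
    have -> : w = w' by apply: (enumerates_unique ew ew' (x := w i)); [exists i|exists i'].
    by exists j'.
  - move=> j sj; apply: (inv_supp invf).
    by have := shift_abs sd (w i) (w j); move: sj; lia.
rewrite /nsum big1 // => y _; apply: shift_out => -[w [ew wx _]].
by apply: nw; exists w.
Qed.

Lemma update_sum sd x : nsum nb (update f sd x) x = d%:Z.
Proof. by rewrite nsumD (inv_sum invf) nsum_shift addr0. Qed.

Lemma update_init sd x y : ~ fin x -> G (x, y) ->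
  (forall j, (j < k.+1)%N -> ~ covered j x y) -> update f sd x y = 1%R.
Proof.
move=> nfx Gxy nc; rewrite /update shift_out ?addr0; last exact: nc.
by apply: (inv_init invf) => // j jk; apply: nc; apply: ltnW.
Qed.

Lemma energy_update sd (w : 'I_k -> X) i : enumerates w ->
  (energy (update f sd) (w i) - energy f (w i) =
   \sum_j ((value_matrix f w (i, j) + perturbation d (value_matrix f w) sd i j) ^+ 2
           - value_matrix f w (i, j) ^+ 2))%R.
Proof.
move=> ew; rewrite /energy /nsum -sumrB.
have := @nsum_range _ _ nb nb_uniq mem_nb _ w
  (fun y => update f sd (w i) y ^+ 2 - f (w i) y ^+ 2)%R (w i) (enumerates_inj ew).
rewrite /nsum => ->.
- by apply: eq_bigr => j _; rewrite /update shift_in // ffunE.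
- move=> y _ uy; have [e|[w' [i' [j' [ew' wi' ->]]]]] := shift_cases f sd (w i) y.
    by rewrite /update e addr0 subrr in uy.
  have -> : w = w' by apply: (enumerates_unique ew ew' (x := w i)); [exists i|exists i'].
  by exists j'.
- move=> j uj; apply: (inv_supp invf); apply: contra_neq uj => f0.
  by rewrite (update_integral sd (or_introl f0)) subrr.
Qed.

Lemma energy_update_out sd x : ~ (exists w : 'I_k -> X, enumerates w /\ range w x) ->
  energy (update f sd) x = energy f x.
Proof.
move=> nw; apply: eq_bigr => y _; rewrite /update shift_out ?addr0 // => -[w [ew wx _]].
by apply: nw; exists w.
Qed.

Definition gain x := (\sum_sd (energy (update f (k := k) sd) x - energy f x))%R.

Lemma gain_ge0 x : (0 <= gain x)%R.
Proof.
have [[w [ew [i _ <-]]]|nw] := pselect (exists w : 'I_k -> X, enumerates w /\ range w x).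
  rewrite /gain (eq_bigr _ (fun sd _ => energy_update sd i ew)).
  exact: sum_sqr_perturbation_ge0.
by rewrite /gain big1 // => sd _; rewrite energy_update_out ?subrr.
Qed.

Section Gain.
Variable c : X -> bool.
Hypothesis colour : forall x y, G (x, y) -> c x != c y.

(** A smaller piece through [a] would be nested strictly inside [range w], which a vertex of the
    core excludes. *)
Lemma core_uncovered (w : 'I_k -> X) a b j : enumerates w -> range w a ->
    ~ (exists L, [/\ T L, L `<` range w & L a]) -> (j < k)%N -> ~ covered j a b.
Proof.
move=> ew wa core jk [w' [ew' w'a _]]; apply: core; exists (range w'); split=> //.
  exact: ew'.2.
have sub := enumerates_subset ew' ew w'a wa (ltnW jk); split=> // sub'.
by have [] := range_subset_card (enumerates_inj ew) sub'; rewrite leqNgt jk.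
Qed.

Lemma fractional_even_subgraph (w : 'I_k -> X) u v L : enumerates w ->
    T L -> L `<` range w -> L (w u) -> L (w v) -> fractional d (value_matrix f w) u v ->
  exists2 z, even_subgraphs (fractional d (value_matrix f w)) z & z (u, v).
Proof.
move=> ew TL Lw Lu Lv Fuv; set N := value_matrix f w in Fuv *.
have NE i j : N (i, j) = f (w i) (w j) by rewrite ffunE.
pose core a := ~ (exists L, [/\ T L, L `<` range w & L a]).
have ncu : ~ core (w u) by apply; exists L.
have ncv : ~ core (w v) by apply; exists L.
have fracG i j : fractional d N i j -> G (w i, w j).
  by rewrite /fractional NE => h; apply: (inv_supp invf); lia.
have nfu : ~ fin (w u).
  by move=> /(inv_fin invf (w v)); move: Fuv; rewrite /fractional NE; lia.
have nf i : connect (fractional d N) u i -> ~ fin (w i).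
  move=> /connectP[p]; elim/last_ind: p i => [|p j IHp] i /=; first by move=> _ ->.
  rewrite rcons_path last_rcons => /andP[/IHp/(_ erefl) nfl /fracG Gi] -> fi.
  by apply: nfl; apply: fin_comp_edge fi => //; apply: simpleG.2.
apply: (@fractional_edge_in_even_subgraph _ d N (c \o w) _ _ _ u v (fun i => `[< core (w i) >])) => //.
- by move=> i j; rewrite !NE (inv_sym invf).
- by move=> i j; rewrite NE (inv_itv invf).
- by move=> i j; rewrite NE => /(inv_supp invf)/colour.
(* Outside the core all neighbours lie in the piece, since it contains [B1] of every strictly
   smaller toast set. *)
- move=> i ui /asboolP/contrapT[L' [TL' L'w L'i]].
  rewrite -(inv_sum invf (w i)) (nsum_range nb_uniq mem_nb (enumerates_inj ew)).
  + by apply: eq_bigr => j _; rewrite NE.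
  + move=> y Gy _; apply: (toast_proper ew.2 TL' L'w); exists (w i) => //.
    by right.
  + by move=> j; apply: (inv_supp invf).
move=> i j /asboolP ci /asboolP cj ui _.
have coreE a : (range w `\` \bigcup_(L in [set L | T L /\ L `<` range w]) L) a <->
    range w a /\ core a.
  split=> [[wa nb']|[wa ca]]; split=> //.
    by move=> [L' [TL' L'w L'a]]; apply: nb'; exists L'.
  by move=> [L' [TL' L'w] L'a]; apply: ca; exists L'.
have [p] : reachable (Defs.induced G
    (range w `\` \bigcup_(L in [set L | T L /\ L `<` range w]) L)) (w i) (w j).
  by apply: toastT.2; [exact: ew.2|apply/coreE; split=> //; exists i|apply/coreE; split=> //; exists j].
elim: p i ci ui => [|b p IHp] i ci ui /=.
  by move=> _ /(enumerates_inj ew) ->; exact: connect0.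
move=> /andP[/asboolP[Gb [/= _ /coreE[[i' _ wi'] cb]]] bp] lp.
rewrite -{}wi' in Gb cb bp lp.
have f1 : f (w i) (w i') = 1%R.
  apply: (inv_init invf) Gb _; first exact: nf.
  by move=> m mk; apply: core_uncovered ew _ ci mk; exists i.
(* [Fuv] forces [d >= 2], so the untouched value 1 is fractional. *)
have Fii' : fractional d N i i'.
  by move: Fuv; rewrite /fractional !NE f1; lia.
apply: (@connect_trans _ _ i'); last first.
  by apply: IHp bp lp => //; apply: connect_trans ui _; apply: connect1.
(* An edge leaving a core vertex is not [uv], whose ends lie in [L]. *)
apply: connect1; rewrite /fractional_off Fii' /=; apply/andP; split; apply/eqP => -[ei _].
  by apply: ncu; rewrite -ei.
by apply: ncv; rewrite -ei.
Qed.

Lemma gain_half x y (w : 'I_k -> X) L : enumerates w -> T L -> L `<` range w ->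
  L x -> L y -> (0 < f x y < d%:Z)%R -> (#|{: seed k}|%:Z <= 2 * gain x)%R.
Proof.
move=> ew TL Lw Lx Ly fxy; have [i _ wi] := properW Lw Lx; have [j _ wj] := properW Lw Ly.
rewrite -wi -wj in Lx Ly fxy *.
have Fij : fractional d (value_matrix f w) i j by rewrite /fractional ffunE.
have [z Hz zij] := fractional_even_subgraph ew TL Lw Lx Ly Fij.
rewrite /gain (eq_bigr _ (fun sd _ => energy_update sd i ew)).
apply: (sum_sqr_perturbation_gain (c := c \o w) _ Hz zij) => a b.
by rewrite ffunE => /(inv_supp invf)/colour.
Qed.

End Gain.
End Update.

(** * Borelness of the stages and of the initial values *)

Section Definability.
Hypotheses (cX : has_cells X) (borelG : borel_set G)
  (amap_lt : amap (fun p : X * X => lt p.1 p.2)).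

Let cW k : has_cells {ptws 'I_k -> X} := ffun_has_cells k cX.

Lemma amap_increasing k : amap (fun w : {ptws 'I_k -> X} => `[< increasing lt w >]).
Proof.
have -> : (fun w : {ptws 'I_k -> X} => `[< increasing lt w >]) =
    fun w => [forall i : 'I_k, [forall j : 'I_k, (i < j)%N ==> lt (w i) (w j)]].
  apply/funext => w; apply/asboolP/forallP => [wi i|wP i j ij].
    by apply/forallP => j; apply/implyP; apply: wi.
  by have := wP i; move=> /forallP/(_ j)/implyP; apply.
apply: amap_all => i; apply: amap_all => j; apply: (amap_comp (fun b => _ ==> b)).
exact: (amap_subst (pair_continuous (@coord_continuous X k i) (@coord_continuous X k j)) amap_lt).
Qed.

Lemma amap_enumerates k : amap (fun w : {ptws 'I_k -> X} => `[< enumerates w >]).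
Proof.
have -> : (fun w : {ptws 'I_k -> X} => `[< enumerates w >]) =
    fun w => `[< increasing lt w >] && `[< T (range w) >].
  by apply/funext => w; rewrite /enumerates asbool_and.
apply: amap_comp2; first exact: amap_increasing.
case: toastT => -[[_ bT] _ _] _.
exact: (@borel_amap _ (cW k) [set w : {ptws 'I_k -> X} | T (range w)] (bT k)).
Qed.

Lemma amap_value_matrix f k : amap (fun p : X * X => f p.1 p.2) ->
  amap (fun w : {ptws 'I_k -> X} => value_matrix f w).
Proof.
move=> af; apply: amap_ffun => -[i j].
exact: (amap_subst (pair_continuous (@coord_continuous X k i) (@coord_continuous X k j)) af).
Qed.

(* For [x] in an infinite component, some piece of size at least [k] contains
   [x], and all pieces of size [k] containing [x] are among its subsets. *)
Lemma not_covered k x y : ~ fin x -> (~ covered k x y <->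
  exists m (w : 'I_m -> X), [/\ (k <= m)%N, enumerates w, range w x &
    forall u : {ffun 'I_k -> 'I_m}, enumerates (w \o u) ->
      ~ (range (w \o u) x /\ range (w \o u) y)]).
Proof.
move=> nfx; split=> [nc|[m [w [km ew wx wu]]] [w' [ew' w'x w'y]]].
  have [L [TL Lx]] : exists L, T L /\ L x.
    have [y' xy'] : exists y', G (x, y').
      apply: contrapT => ny; apply: nfx; apply: sub_finite_set (finite_set1 x).
      move=> z [[|a p] /=]; first by move=> _ <-.
      by move=> /andP[/asboolP xa]; case: ny; exists a.
    by have [K [TK Kx _]] := toast_edge xy'; exists K.
  have [m [w [ew km Lw]]] := toast_unbounded k nfx TL Lx.
  exists m, w; split=> //; [exact: ltnW|exact: properW Lw x Lx|].
  by move=> u eu [ux uy]; apply: nc; exists (w \o u).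
have sub := enumerates_subset ew' ew w'x wx km.
have /choice[u uP] i : exists j, w j = w' i.
  by have [|j _ <-] := sub (w' i); [exists i|exists j].
have uE : w \o [ffun i => u i] = w' by apply/funext => i; rewrite /= ffunE uP.
by apply: (wu [ffun i => u i]); rewrite uE.
Qed.

Let fC k : continuous (fun z : (X * X) * {ptws 'I_k -> X} => z.1).
Proof. by move=> p; apply: cvg_fst. Qed.
Let sC k : continuous (fun z : (X * X) * {ptws 'I_k -> X} => z.2).
Proof. by move=> p; apply: cvg_snd. Qed.
Let f1C k : continuous (fun z : (X * X) * {ptws 'I_k -> X} => z.1.1).
Proof. by apply: continuous_comp2 (@fC k) _ => p; apply: cvg_fst. Qed.
Let f2C k : continuous (fun z : (X * X) * {ptws 'I_k -> X} => z.1.2).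
Proof. by apply: continuous_comp2 (@fC k) _ => p; apply: cvg_snd. Qed.
Let iC k i : continuous (fun z : (X * X) * {ptws 'I_k -> X} => z.2 i).
Proof. exact: continuous_comp2 (@sC k) (@coord_continuous X k i). Qed.

Lemma existsbP k (w : 'I_k -> X) x : reflect (range w x) [exists i, w i == x].
Proof.
apply: (iffP existsP) => [[i /eqP <-]|[i _ <-]]; first by exists i.
by exists i.
Qed.

(** A universal quantifier over tuples of [X] would destroy analyticity; inside one larger piece it
    becomes a quantifier over finitely many maps [u]. *)
Lemma not_covered_analytic k : exists2 A : set (X * X), analytic A &
  forall x y, ~ fin x -> (~ covered k x y <-> A (x, y)).
Proof.
pose P m (z : (X * X) * {ptws 'I_m -> X}) := [&& `[< enumerates z.2 >],
  [exists i, z.2 i == z.1.1] & [forall u : {ffun 'I_k -> 'I_m},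
    `[< enumerates (z.2 \o u) >] ==>
      ~~ ([exists i, z.2 (u i) == z.1.1] && [exists i, z.2 (u i) == z.1.2])]].
exists [set p | exists m, ([set _ | (k <= m)%N] `&`
    [set p | exists w, [set z | P m z] (p, w)]) p].
  apply: analytic_ex => m; apply: analyticI; first exact: analytic_const.
  apply: (exists_analytic (cW m)); apply: amap_bool.
  apply: amap_comp2; first exact: amap_subst (@sC m) (@amap_enumerates m).
  apply: amap_comp2.
    by apply: amap_exists => i; apply: (amap_eq2 cX) => //; [exact: iC|exact: f1C].
  apply: amap_all => u; apply: amap_comp2.
    have := amap_subst (continuous_comp2 (@sC m) (@reindex_continuous X m k u)) (@amap_enumerates k).
    by [].
  apply: (amap_comp negb); apply: amap_comp2; apply: amap_exists => i;
    by apply: (amap_eq2 cX); [exact: iC|first [exact: f1C|exact: f2C]].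
move=> x y nfx; rewrite not_covered //; split.
  move=> [m [w [km ew wx wu]]]; exists m; split=> //; exists w; apply/and3P; split=> /=.
  - exact/asboolP.
  - exact/existsbP.
  - apply/forallP => u; apply/implyP => /asboolP eu; apply/negP => /andP[ux uy].
    by apply: (wu u eu); split; apply/existsbP.
move=> [m [km [w /and3P[/= /asboolP ew /existsbP wx /forallP wu]]]].
exists m, w; split=> // u eu [/existsbP ux /existsbP uy].
by have /implyP := wu u; rewrite ux uy => /(_ (asboolT eu)).
Qed.

Lemma amap_fin_fst : amap (fun p : X * X => `[< fin p.1 >]).
Proof.
have fstC : continuous (fst : X * X -> X) by move=> p; apply: cvg_fst.
by have := amap_subst fstC (amap_fin_comp nb_uniq size_nb mem_nb cX borelG).
Qed.

(** On finite components the values are integral and do not change; on infinite ones both being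
    covered and not being covered are analytic. *)
Lemma amap_update k f (sd : seed k) : invariant k f ->
  amap (fun p : X * X => update f sd p.1 p.2).
Proof.
move=> invf v; have [A aA AE] := not_covered_analytic k.
have af := inv_amap invf; have aF := amap_fin_fst.
pose P (z : (X * X) * {ptws 'I_k -> X}) := `[< enumerates z.2 >] &&
  [exists i, [exists j, [&& z.2 i == z.1.1, z.2 j == z.1.2 &
    (value_matrix f z.2 (i, j) + perturbation d (value_matrix f z.2) sd i j == v)]]].
have aP : analytic [set p | exists w, [set z | P z] (p, w)].
  apply: (exists_analytic (cW k)); apply: amap_bool.
  apply: amap_comp2; first exact: amap_subst (@sC k) (@amap_enumerates k).
  apply: amap_exists => i; apply: amap_exists => j.
  apply: amap_comp2; first by apply: (amap_eq2 cX); [exact: iC|exact: f1C].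
  apply: amap_comp2; first by apply: (amap_eq2 cX); [exact: iC|exact: f2C].
  apply: (amap_comp (fun N : {ffun 'I_k * 'I_k -> int} =>
    N (i, j) + perturbation d N sd i j == v)).
  exact: amap_subst (@sC k) (@amap_value_matrix f k af).
have -> : [set p | update f sd p.1 p.2 = v] =
    ([set p | `[< fin p.1 >]] `&` [set p | f p.1 p.2 = v]) `|`
    ([set p | ~~ `[< fin p.1 >]] `&`
      ([set p | exists w, [set z | P z] (p, w)] `|` (A `&` [set p | f p.1 p.2 = v]))).
  apply/seteqP; split=> [[x y] /= uv|[x y] /=].
    have [fx|nfx] := pselect (fin x).
      left; split; first exact/asboolP.
      by rewrite -(update_integral sd (inv_fin invf y fx)).
    right; split; first by apply/negP => /asboolP.
    have [[w [ew [i _ wi] [j _ wj]]]|nc] := pselect (covered k x y); last first.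
      right; split; first exact/AE.
      by rewrite -uv /update shift_out ?addr0.
    left; exists w; apply/andP; split; first exact/asboolP.
    apply/existsP; exists i; apply/existsP; exists j; rewrite /= wi wj !eqxx /=.
    by rewrite -uv /update -wi -wj shift_in // ffunE.
  move=> [[/asboolP fx <-]|[/asboolPn nfx [[w]|[Axy <-]]]].
  - by rewrite (update_integral sd (inv_fin invf y fx)).
  - move=> /andP[/= /asboolP ew /existsP[i /existsP[j /and3P[/eqP <- /eqP <- /eqP <-]]]].
    by rewrite /update shift_in // ffunE.
  - by rewrite /update shift_out ?addr0 //; apply/(AE _ _ nfx).
apply: analyticU; apply: analyticI.
- exact: amap_bool.
- exact: af.
- exact: amap_bool (amap_comp negb aF).
- by apply: analyticU => //; apply: analyticI => //; exact: af.
Qed.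

Lemma update_invariant k f (sd : seed k) : invariant k f -> invariant k.+1 (update f sd).
Proof.
move=> invf; split.
- exact: update_sym.
- exact: update_supp.
- exact: update_itv.
- exact: update_sum.
- exact: amap_update.
- by move=> x y fx; have h := inv_fin invf y fx; rewrite (update_integral sd h).
- exact: update_init.
Qed.

Section Initial.
Variable c : X -> bool.
Hypotheses (colour : forall x y, G (x, y) -> c x != c y) (d_gt0 : (0 < d)%N).

Definition integral_matching k (A : {ffun 'I_k * 'I_k -> bool}) (M : {ffun 'I_k * 'I_k -> int}) :=
  [/\ forall i j, M (i, j) = M (j, i), forall i j, M (i, j) = 0 \/ M (i, j) = d%:Z,
      forall i j, ~~ A (i, j) -> M (i, j) = 0 & forall i, \sum_j M (i, j) = d%:Z].

(** The choice depends on the adjacency matrix alone, a datum from a finite set, which keeps the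
    initial values Borel. *)
Definition component_matching k (A : {ffun 'I_k * 'I_k -> bool}) : {ffun 'I_k * 'I_k -> int} :=
  if pselect (exists M, integral_matching A M) is left e then projT1 (cid e) else 0.

Definition enumerates_component k (w : 'I_k -> X) x := increasing lt w /\ range w = component G x.

Lemma component_matchingP k (w : 'I_k -> X) x : enumerates_component w x ->
  integral_matching (adj_matrix G w) (component_matching (adj_matrix G w)).
Proof.
move=> [wi wx]; rewrite /component_matching; case: pselect => [e|[]]; first exact: (projT2 (cid e)).
have winj := increasing_inj lt_irr wi.
pose N : {ffun 'I_k * 'I_k -> int} := [ffun p => (adj_matrix G w p : nat)%:Z].
have NE i j : N (i, j) = (adj G (w i) (w j) : nat) by rewrite !ffunE.
have [] := @integral_point _ d N (c \o w).
- move=> i j; rewrite !NE; congr (nat_of_bool _)%:Z.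
  by apply/asboolP/asboolP; apply: simpleG.2.
- by move=> i j; rewrite NE; case: adj; lia.
- by move=> i j; rewrite NE; case: adjP => // /colour.
- move=> i; have := @nsum_range _ _ nb nb_uniq mem_nb _ w
    (fun y => (adj G (w i) y : nat)%:Z) (w i) winj.
  rewrite (eq_bigr _ (fun j _ => NE i j)) => <- //.
  + rewrite /nsum (eq_big_seq (fun=> 1)) => [|y]; last by rewrite mem_nb => ->.
    by rewrite big_const_seq count_predT size_nb iter_addr_0 natz.
  + move=> y Gy _; rewrite wx; have : component G x (w i) by rewrite -wx; exists i.
    by move=> /reachable_trans; apply; apply: reachable_edge.
  + by move=> j; case: adjP.
move=> M [MC MI M0 Ms]; exists M; split=> // i j; rewrite ffunE => nA.
by apply: M0; rewrite NE (negbTE nA).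
Qed.

(** The dependent pair carries the unknown size of the component; increasing enumerations being
    unique, the chosen one is immaterial, see [initial_in]. *)
Definition initial x y : int :=
  if `[< fin x >] then
    if pselect (exists p : {k & ('I_k -> X) * 'I_k * 'I_k}%type,
        [/\ enumerates_component (projT2 p).1.1 x, (projT2 p).1.1 (projT2 p).1.2 = x &
            (projT2 p).1.1 (projT2 p).2 = y]) is left e
    then let p := projT1 (cid e) in
      component_matching (adj_matrix G (projT2 p).1.1) ((projT2 p).1.2, (projT2 p).2)
    else 0
  else (adj G x y : nat)%:Z.

Lemma initial_in k (w : 'I_k -> X) i j : enumerates_component w (w i) ->
  initial (w i) (w j) = component_matching (adj_matrix G w) (i, j).
Proof.
move=> ew; have fi : fin (w i).
  by rewrite /fin_comp -ew.2; apply: finite_image; exact: finite_finset.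
rewrite /initial asboolT //; case: pselect => [e|[]]; last first.
  by exists (existT _ k (w, i, j)).
case: (projT2 (cid e)) => [ew' wi wj].
move: (projT1 (cid e)) ew' wi wj => [k' [[w' i'] j']] /= ew' wi wj.
have r : range w' = range w by rewrite ew.2 ew'.2.
have winj := increasing_inj lt_irr ew.1; have winj' := increasing_inj lt_irr ew'.1.
have kk' : k' = k.
  apply/eqP; rewrite eqn_leq.
  have [|-> _] := range_subset_card (w' := w) winj'; first by rewrite r.
  by have [|-> _] := range_subset_card (w' := w') winj; first by rewrite r.
subst k'; have ww' := increasing_unique lt_irr lt_trans ew'.1 ew.1 r.
by subst w'; rewrite (winj _ _ wi) (winj _ _ wj).
Qed.

Lemma fin_enumerates x : fin x -> exists k (w : 'I_k -> X) i, enumerates_component w x /\ w i = x.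
Proof.
move=> fx; have [k [w [wi wx]]] := finite_increasing lt_trans lt_total fx.
have [i _ ix] : range w x by rewrite wx; exact: reachable_refl.
by exists k, w, i.
Qed.

Lemma initial_fin x y : fin x -> exists k (w : 'I_k -> X) i,
  [/\ enumerates_component w x, w i = x & initial x y = 0 \/
    exists2 j, y = w j & initial x y = component_matching (adj_matrix G w) (i, j)].
Proof.
move=> fx; have [k [w [i [ew wi]]]] := fin_enumerates fx; exists k, w, i; split=> //.
have [xy|nxy] := pselect (component G x y).
  right; have [j _ wj] : range w y by rewrite ew.2.
  by exists j => //; rewrite -{1}wi -wj initial_in // wi.
left; rewrite /initial asboolT //; case: pselect => // -[[k' [[w' i'] j']] /= [ew' wi' wj']].
by case: nxy; rewrite -ew'.2; exists j'.
Qed.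

Lemma initial_covered x y k (w : 'I_k -> X) i j :
  enumerates_component w x -> w i = x -> w j = y ->
  initial x y = component_matching (adj_matrix G w) (i, j).
Proof. by move=> ew wi wj; rewrite -wi -wj; apply: initial_in; rewrite wi. Qed.

Definition lists_component k (w : 'I_k -> X) := [&& `[< increasing lt w >],
  full_matrix d (adj_matrix G w) &
  [forall i, [forall j, connect (fun a b => adj_matrix G w (a, b)) i j]]].

(** Full rows give closure under adjacency and [connect] gives connectedness, so apart from the
    order only the finite adjacency matrix is consulted. *)
Lemma lists_componentP k (w : 'I_k -> X) i :
  lists_component w <-> enumerates_component w (w i).
Proof.
split=> [/and3P[/asboolP wi wf /forallP wc]|[wi wx]].
  split=> //; apply/seteqP; split; last first.
    exact: (full_component nb_uniq size_nb mem_nb (i := i) (increasing_inj lt_irr wi) wf).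
  move=> _ [j _ <-]; have /forallP/(_ j)/connectP[p] := wc i.
  elim: p i => [|a p IHp] i /= => [_ ->|]; first exact: reachable_refl.
  rewrite ffunE => /andP[/asboolP ia ap] jl.
  by apply: reachable_trans (reachable_edge ia) _; apply: IHp.
have winj := increasing_inj lt_irr wi.
have cl a y : G (w a, y) -> range w y.
  rewrite wx => ay; have : component G (w i) (w a) by rewrite -wx; exists a.
  by move=> /reachable_trans; apply; apply: reachable_edge.
apply/and3P; split; first exact/asboolP.
  by apply/(full_matrixP nb_uniq size_nb mem_nb winj).
apply/forallP => a; apply/forallP => b.
have ra e : reachable G (w i) (w e) by have : range w (w e) by [exists e]; rewrite wx.
have [p] : reachable G (w a) (w b) by apply: reachable_trans (reachable_sym simpleG (ra a)) (ra b).
elim: p a => [|y p IHp] a /=; first by move=> _ /winj ->; exact: connect0.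
move=> /andP[/asboolP ay yp] lp; have [e _ we] := cl _ _ ay.
rewrite -we in ay yp lp; apply: connect_trans (IHp _ yp lp).
by apply: connect1; rewrite ffunE; apply/asboolP.
Qed.

Lemma amap_initial : amap (fun p : X * X => initial p.1 p.2).
Proof.
move=> v; have aF := amap_fin_fst; have aG := amap_adj cX borelG.
have aGv : amap (fun p : X * X => (adj G p.1 p.2 : nat)%:Z) :=
  amap_comp (fun b : bool => (b : nat)%:Z) aG.
pose P k (z : (X * X) * {ptws 'I_k -> X}) := lists_component z.2 &&
  [exists i, [exists j, [&& z.2 i == z.1.1, z.2 j == z.1.2 &
    component_matching (adj_matrix G z.2) (i, j) == v]]].
have aP : analytic [set p | exists k, [set p | exists w, [set z | P k z] (p, w)] p].
  apply: analytic_ex => k; apply: (exists_analytic (cW k)); apply: amap_bool.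
  have aA : amap (fun z : (X * X) * {ptws 'I_k -> X} => adj_matrix G z.2).
    by have := amap_subst (@sC k) (amap_adj_matrix cX borelG (k := k)).
  apply: amap_comp2.
    apply: amap_comp2; first exact: amap_subst (@sC k) (@amap_increasing k).
    apply: amap_comp2; first exact: amap_comp aA.
    exact: (amap_comp (fun A : {ffun 'I_k * 'I_k -> bool} =>
      [forall i, [forall j, connect (fun a b => A (a, b)) i j]]) aA).
  apply: amap_exists => i; apply: amap_exists => j.
  apply: amap_comp2; first by apply: (amap_eq2 cX); [exact: iC|exact: f1C].
  apply: amap_comp2; first by apply: (amap_eq2 cX); [exact: iC|exact: f2C].
  exact: (amap_comp (fun A : {ffun 'I_k * 'I_k -> bool} => component_matching A (i, j) == v) aA).
have init0 x y : fin x -> ~ G (x, y) -> initial x y = 0.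
  move=> fx nG; have [k [w [i [ew wi [//|[j wj ->]]]]]] := initial_fin y fx.
  have [_ _ M0 _] := component_matchingP ew; apply: M0.
  by rewrite ffunE /= wi -wj; apply/negP => /asboolP.
have -> : [set p | initial p.1 p.2 = v] =
    ([set p | ~~ `[< fin p.1 >]] `&` [set p | (adj G p.1 p.2 : nat)%:Z = v]) `|`
    ([set p | `[< fin p.1 >]] `&`
      ([set p | exists k, [set p | exists w, [set z | P k z] (p, w)] p] `|`
       ([set p | ~~ adj G p.1 p.2] `&` [set _ | 0 = v]))).
  apply/seteqP; split=> [[x y] /= uv|[x y] /=].
    have [fx|nfx] := pselect (fin x); last first.
      left; split; first by apply/negP => /asboolP.
      by rewrite -uv /initial asboolF.
    right; split; first exact/asboolP.
    have [k [w [i [ew wi]]]] := fin_enumerates fx.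
    have [[j _ wj]|nwy] := pselect (range w y); last first.
      have nG : ~ G (x, y).
        by move=> xy; apply: nwy; rewrite ew.2; apply: reachable_edge.
      by right; split; [apply/negP => /asboolP|rewrite -uv init0].
    left; exists k, w; apply/andP; split=> /=.
      by apply/(lists_componentP _ i); rewrite wi.
    apply/existsP; exists i; apply/existsP; exists j; rewrite wi wj !eqxx /=.
    by rewrite -uv (initial_covered ew wi wj).
  move=> [[/asboolPn nfx <-]|[/asboolP fx [[k [w]]|[/asboolPn nG <-]]]].
  - by rewrite /initial asboolF.
  - move=> /andP[/= lw /existsP[i /existsP[j /and3P[/eqP <- /eqP <- /eqP <-]]]].
    exact/initial_in/lists_componentP.
  - exact: init0.
apply: analyticU; apply: analyticI.
- exact: amap_bool (amap_comp negb aF).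
- exact: aGv.
- exact: amap_bool.
- apply: analyticU => //; apply: analyticI; last exact: analytic_const.
  exact: amap_bool (amap_comp negb aG).
Qed.

Lemma initial_invariant : invariant 0 initial.
Proof.
have adjC x y : adj G x y = adj G y x by apply/asboolP/asboolP; apply: simpleG.2.
have comp_fin x y : component G x y -> fin x -> fin y.
  by move=> xy; rewrite /fin_comp (component_eq simpleG xy).
have in_comp k (w : 'I_k -> X) x i : enumerates_component w x -> enumerates_component w (w i).
  move=> ew; split; first exact: ew.1.
  have : component G x (w i) by rewrite -ew.2; exists i.
  by move=> /(component_eq simpleG) <-; exact: ew.2.
have val x y : fin x -> initial x y = 0 \/ initial x y = d%:Z.
  move=> fx; have [k [w [i [ew wi [e|[j wj ->]]]]]] := initial_fin y fx; first by left.
  by have [_ M01 _ _] := component_matchingP ew; apply: M01.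
split.
- move=> x y; have [fx|nfx] := pselect (fin x); have [fy|nfy] := pselect (fin y).
  + have half a b : fin a -> fin b -> initial a b != 0 -> initial a b = initial b a.
      move=> fa fb; have [k [w [i [ew wi [->|[j wj e]]]]]] := initial_fin b fa.
        by rewrite eqxx.
      move=> _; rewrite e wj -wi initial_in; last exact: in_comp ew.
      by have [MC _ _ _] := component_matchingP ew; rewrite MC.
    have [xy0|/(half _ _ fx fy)//] := eqVneq (initial x y) 0.
    by have [yx0|/(half _ _ fy fx)//] := eqVneq (initial y x) 0; rewrite xy0 yx0.
  + have [k [w [i [ew wi [->|[j wj]]]]]] := initial_fin y fx.
      rewrite /initial asboolF // adjC; case: adjP => // yx; case: nfy.
      by apply: fin_comp_edge fx => //.
    by case: nfy; apply: comp_fin fx; rewrite -ew.2; exists j.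
  + have [k [w [i [ew wi [->|[j wj]]]]]] := initial_fin x fy.
      rewrite /initial asboolF // adjC; case: adjP => // yx; case: nfx.
      by apply: fin_comp_edge fy => //.
    by case: nfx; apply: comp_fin fy; rewrite -ew.2; exists j.
  + by rewrite /initial !asboolF // adjC.
- move=> x y; have [fx|nfx] := pselect (fin x); last first.
    by rewrite /initial asboolF //; case: adjP.
  have [k [w [i [ew wi [->|[j wj ->]]]]]] := initial_fin y fx; first by rewrite eqxx.
  have [_ _ M0 _] := component_matchingP ew; apply: contra_neqP => nG.
  by apply: M0; rewrite ffunE /= wi -wj; apply/negP => /asboolP.
- move=> x y; have [fx|nfx] := pselect (fin x); last first.
    by rewrite /initial asboolF //; case: adj; lia.
  by have [->|->] := val x y fx; rewrite lexx.
- move=> x; have [fx|nfx] := pselect (fin x); last first.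
    rewrite /nsum (eq_big_seq (fun=> 1)) => [|y].
      by rewrite big_const_seq count_predT size_nb iter_addr_0 natz.
    by rewrite mem_nb /initial asboolF // => ->.
  have [k [w [i [ew wi]]]] := fin_enumerates fx; rewrite -wi in ew *.
  have [_ _ M0 Ms] := component_matchingP ew.
  rewrite (nsum_range nb_uniq mem_nb (increasing_inj lt_irr ew.1)).
  + by rewrite -(Ms i); apply: eq_bigr => j _; rewrite initial_in.
  + by move=> y Gy _; rewrite ew.2; apply: reachable_edge.
  + move=> j; rewrite initial_in //; apply: contra_neqP => nG; apply: M0.
    by rewrite ffunE; apply/negP => /asboolP.
- exact: amap_initial.
- exact: val.
- by move=> x y nfx Gxy _; rewrite /initial asboolF // (introT (adjP _ _ _) Gxy).
Qed.

End Initial.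
End Definability.
End Toast.

End Toasts.

(** * Weighted energies and the limit matching *)

Section Energies.
Local Open Scope ring_scope.
Local Open Scope classical_set_scope.

Section Mean.
Variables (R : realType) (X : ptopologicalType) (mu : probability (borel X) R).
Hypothesis cX : has_cells X.

Definition bounded_amap (h : X -> int) :=
  [/\ amap h, forall x, 0 <= h x & exists C : nat, forall x, h x <= C%:Z].

Definition mean (h : X -> int) : R := fine (\int[mu]_x ((h x)%:~R : R)%:E).

Lemma amap_measurable (h : X -> int) : amap h ->
  measurable_fun setT (fun x : borel X => ((h x)%:~R : R)%:E).
Proof.
by move=> ah _ Y _; rewrite setTI; exact: (amap_borel cX (fun v : int => Y ((v%:~R : R)%:E)) ah).
Qed.

Lemma bounded_amapD h k : bounded_amap h -> bounded_amap k -> bounded_amap (fun x => h x + k x).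
Proof.
move=> [ah h0 [C hC]] [ak k0 [D kD]]; split.
- exact: amap_comp2.
- by move=> x; rewrite addr_ge0.
- by exists (C + D)%N => x; rewrite PoszD lerD.
Qed.

Lemma bounded_amap_sum (S : finType) (h : S -> X -> int) :
  (forall s, bounded_amap (h s)) -> bounded_amap (fun x => \sum_s h s x).
Proof.
move=> bh; split.
- by apply: amap_sum => s; have [] := bh s.
- by move=> x; apply: sumr_ge0 => s _; have [] := bh s.
have /choice[C hC] s : exists C : nat, forall x, h s x <= C%:Z by have [] := bh s.
exists (\sum_s C s)%N => x; rewrite (big_morph Posz PoszD (erefl 0%:Z)).
by apply: ler_sum => s _.
Qed.

Lemma integral_intr_itv h (C : nat) : bounded_amap h -> (forall x, h x <= C%:Z) ->
  (0 <= \int[mu]_x ((h x)%:~R : R)%:E <= C%:R%:E)%E.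
Proof.
move=> [ah h0 _] hC; apply/andP; split.
  by apply: integral_ge0 => x _; rewrite lee_fin ler0z.
have -> : (C%:R%:E = \int[mu]_x (cst (C%:R : R)%:E x))%E.
  by rewrite integral_cst // [X in (_ * X)%E](probability_setT mu) mule1.
apply: ge0_le_integral => //.
- by move=> x _; rewrite lee_fin ler0z.
- exact: amap_measurable.
- by move=> x _; rewrite lee_fin -[C%:R]/(C%:Z%:~R) ler_int.
Qed.

Lemma mean_fin h : bounded_amap h ->
  (\int[mu]_x ((h x)%:~R : R)%:E = (mean h)%:E)%E.
Proof.
move=> bh; have [_ _ [C hC]] := bh; rewrite /mean fineK //.
have /andP[i0 iC] := integral_intr_itv bh hC.
by rewrite ge0_fin_numE //; apply: le_lt_trans iC _; rewrite ltry.
Qed.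

Lemma mean_ge0 h : bounded_amap h -> 0 <= mean h.
Proof.
move=> bh; have [_ _ [C hC]] := bh; have /andP[] := integral_intr_itv bh hC.
by rewrite mean_fin.
Qed.

Lemma mean_le h (C : nat) : bounded_amap h -> (forall x, h x <= C%:Z) -> mean h <= C%:R.
Proof.
by move=> bh hC; have /andP[_] := integral_intr_itv bh hC; rewrite mean_fin // lee_fin.
Qed.

Lemma meanD h k : bounded_amap h -> bounded_amap k ->
  mean (fun x => h x + k x) = mean h + mean k.
Proof.
move=> bh bk; apply: EFin_inj; rewrite EFinD -!mean_fin //; last exact: bounded_amapD.
have [ah h0 _] := bh; have [ak k0 _] := bk.
rewrite -ge0_integralD //.
- by apply: eq_integral => x _; rewrite intrD EFinD.
- by move=> x _; rewrite lee_fin ler0z.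
- exact: amap_measurable.
- by move=> x _; rewrite lee_fin ler0z.
- exact: amap_measurable.
Qed.

Lemma mean_mono h k : bounded_amap h -> bounded_amap k ->
  (forall x, h x <= k x) -> mean h <= mean k.
Proof.
move=> bh bk hk; rewrite -lee_fin -!mean_fin //.
have [ah h0 _] := bh; have [ak _ _] := bk.
apply: ge0_le_integral => //.
- by move=> x _; rewrite lee_fin ler0z.
- exact: amap_measurable.
- exact: amap_measurable.
- by move=> x _; rewrite lee_fin ler_int.
Qed.

(** Markov's inequality: a nonzero natural value is at least 1. *)
Lemma measure_support_le h : bounded_amap h ->
  (mu [set x | (h x != 0)%R] <= (mean h)%:E)%E.
Proof.
move=> bh; have [ah h0 _] := bh; rewrite -mean_fin //.
have mA : measurable ([set x | h x != 0] : set (borel X)).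
  exact: (amap_borel cX (fun v : int => v != 0) ah).
rewrite -[X in mu X]setIT -integral_indic //; apply: ge0_le_integral => //.
- exact/measurable_EFinP/measurable_indic.
- exact: amap_measurable.
move=> x _; rewrite lee_fin indicE; case: (boolP (x \in _)) => [/set_mem/= hx|_].
  by rewrite (ler_int _ 1); have := h0 x; lia.
by rewrite ler0z.
Qed.

(** * Energies summed over weighted walks *)

Section Potential.
Variables (G : set (X * X)) (d : nat) (nb : X -> seq X).
Hypotheses (nb_uniq : forall x, uniq (nb x)) (size_nb : forall x, size (nb x) = d)
  (mem_nb : forall x y, (y \in nb x) = adj G x y) (borelG : borel_set G) (d_gt0 : (0 < d)%N).

(** The [n]-th power of the adjacency operator: it sums [h] over the ends of all walks of length
    [n]. *)
Definition walk_sum n (h : X -> int) : X -> int := iter n (nsum nb) h.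

Lemma nsum_bounded (h : X -> X -> int) (C : nat) : amap (fun p : X * X => h p.1 p.2) ->
    (forall x y, 0 <= h x y <= C%:Z) ->
  bounded_amap (fun x => nsum nb (h x) x) /\ forall x, nsum nb (h x) x <= (d * C)%N%:Z.
Proof.
move=> ah hC; have le x : nsum nb (h x) x <= (d * C)%N%:Z.
  rewrite -(size_nb x) /nsum; elim: (nb x) => [|y s IHs]; first by rewrite big_nil.
  by rewrite big_cons /= mulSn PoszD lerD //; have /andP[] := hC x y.
split=> //; split; last by exists (d * C)%N.
  exact: amap_nsum ah.
by move=> x; apply: sumr_ge0 => y _; have /andP[] := hC x y.
Qed.

Lemma walk_sum_bounded n h (C : nat) : bounded_amap h -> (forall x, h x <= C%:Z) ->
  bounded_amap (walk_sum n h) /\ forall x, walk_sum n h x <= (d ^ n * C)%N%:Z.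
Proof.
move=> bh hC; elim: n => [|n [[an n0 _] nC]]; first by rewrite expn0 mul1n.
rewrite expnS -mulnA; apply: nsum_bounded => [|x y]; last by rewrite n0 nC.
by apply: (amap_subst (f := snd)) an => p; apply: cvg_snd.
Qed.

Lemma bounded_walk_sum n h : bounded_amap h -> bounded_amap (walk_sum n h).
Proof. by move=> bh; have [_ _ [C hC]] := bh; have [] := walk_sum_bounded n bh hC. Qed.

Lemma walk_sumD n h k : walk_sum n (fun x => h x + k x) = fun x => walk_sum n h x + walk_sum n k x.
Proof.
elim: n => // n IHn; rewrite /walk_sum iterS -/(walk_sum _ _) IHn.
by apply/funext => x; rewrite nsumD.
Qed.

Lemma walk_sum_mono n h k : (forall x, h x <= k x) -> forall x, walk_sum n h x <= walk_sum n k x.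
Proof. by move=> hk; elim: n => // n IHn x; apply: ler_sum => y _; apply: IHn. Qed.

Lemma walk_sum_path n h x p : (forall x, 0 <= h x) -> path (adj G) x p -> size p = n ->
  h (last x p) != 0 -> walk_sum n h x != 0.
Proof.
move=> h0; elim: p n x => [|y p IHp] [|n] x //= /andP[xy yp] [sp] hl.
have wge0 m z : 0 <= walk_sum m h z by elim: m z => // m IHm z; apply: sumr_ge0 => u _; apply: IHm.
rewrite gt_eqF // /nsum (big_rem y) ?mem_nb //= ltr_wpDr //.
  by apply: sumr_ge0 => z _; apply: wge0.
by rewrite lt_neqAle wge0 eq_sym (IHp n y yp sp hl).
Qed.

Lemma walk_sum_neq0 n h x : walk_sum n h x != 0 -> exists p,
  path (adj G) x p /\ h (last x p) != 0.
Proof.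
elim: n x => [|n IHn] x /= hx; first by exists [::].
have [y yx hy] : exists2 y, y \in nb x & walk_sum n h y != 0.
  apply: contrapT => ny; move/eqP: hx; apply; apply: big1_seq => y /andP[_ yx].
  by apply/eqP; apply: contrapT => /negP hy; apply: ny; exists y.
have [p [yp hp]] := IHn y hy; exists (y :: p); split=> //=.
by rewrite yp -mem_nb yx.
Qed.

(** There are [d ^ n] walks of length [n] from a point, so the total is at most twice an upper bound
    of [h]. Truncating at [N] avoids infinite series. *)
Definition potential N h : R := \sum_(n < N) (2 * d%:R) ^- n * mean (walk_sum n h).

Let w_ge0 n : 0 <= (2 * d%:R : R) ^- n.
Proof. by rewrite invr_ge0 exprn_ge0 // mulr_ge0. Qed.

Lemma potentialD N h k : bounded_amap h -> bounded_amap k ->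
  potential N (fun x => h x + k x) = potential N h + potential N k.
Proof.
move=> bh bk; rewrite -big_split; apply: eq_bigr => n _ /=.
by rewrite walk_sumD meanD ?mulrDr //; apply: bounded_walk_sum.
Qed.

Lemma potential_mono N h k : bounded_amap h -> bounded_amap k ->
  (forall x, h x <= k x) -> potential N h <= potential N k.
Proof.
move=> bh bk hk; apply: ler_sum => n _; rewrite ler_wpM2l //.
by apply: mean_mono; [exact: bounded_walk_sum|exact: bounded_walk_sum|exact: walk_sum_mono].
Qed.

Lemma potential_ge0 N h : bounded_amap h -> 0 <= potential N h.
Proof.
by move=> bh; apply: sumr_ge0 => n _; rewrite mulr_ge0 // mean_ge0 //; exact: bounded_walk_sum.
Qed.

Lemma bounded_amap0 : bounded_amap (fun=> 0).
Proof. by split=> //; [exact: amap_cst|exists 0%N]. Qed.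

Lemma potential_sum N (S : finType) (h : S -> X -> int) : (forall s, bounded_amap (h s)) ->
  potential N (fun x => \sum_s h s x) = \sum_s potential N (h s).
Proof.
move=> bh; have p0 : potential N (fun=> 0) = 0.
  have := potentialD N bounded_amap0 bounded_amap0.
  by rewrite (_ : (fun x : X => 0 + 0 : int) = fun=> 0) ?addr0 //; lra.
suff : forall r : seq S, bounded_amap (fun x => \sum_(s <- r) h s x) /\
  potential N (fun x => \sum_(s <- r) h s x) = \sum_(s <- r) potential N (h s).
  by move=> /(_ (index_enum S))[].
elim=> [|s r [br IHr]].
  have -> : (fun x => \sum_(s <- [::]) h s x) = (fun=> 0).
    by apply/funext => x; rewrite big_nil.
  by rewrite big_nil; split; first exact: bounded_amap0.
have -> : (fun x => \sum_(t <- s :: r) h t x) = (fun x => h s x + \sum_(t <- r) h t x).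
  by apply/funext => x; rewrite big_cons.
by rewrite big_cons potentialD // IHr; split=> //; apply: bounded_amapD.
Qed.

Lemma potential_le N h (C : nat) : bounded_amap h -> (forall x, h x <= C%:Z) ->
  potential N h <= 2 * C%:R.
Proof.
move=> bh hC; have geo : \sum_(n < N) (2 : R) ^- n = 2 - 2 * 2 ^- N.
  elim: N => [|N IHN]; first by rewrite big_ord0 expr0 invr1; lra.
  by rewrite big_ord_recr /= IHN exprS invfM; lra.
apply: (@le_trans _ _ (\sum_(n < N) 2 ^- n * C%:R)).
  apply: ler_sum => n _; have [bw wC] := walk_sum_bounded n bh hC.
  apply: le_trans (ler_wpM2l (w_ge0 n) (mean_le bw wC)) _.
  rewrite natrM natrX exprMn invfM -mulrA mulKf // expf_neq0 // pnatr_eq0 -lt0n //.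
rewrite -mulr_suml geo ler_wpM2r //.
by rewrite gerBl mulr_ge0 // invr_ge0 exprn_ge0.
Qed.

Lemma potentialS N h : bounded_amap h -> potential N h <= potential N.+1 h.
Proof.
move=> bh; rewrite /potential big_ord_recr /= lerDl mulr_ge0 // mean_ge0 //.
exact: bounded_walk_sum.
Qed.

Lemma potential_term N n h : bounded_amap h -> (n < N)%N ->
  (2 * d%:R) ^- n * mean (walk_sum n h) <= potential N h.
Proof.
move=> bh nN; rewrite /potential (bigD1 (Ordinal nN)) //= lerDl sumr_ge0 // => m _.
by rewrite mulr_ge0 // mean_ge0 //; exact: bounded_walk_sum.
Qed.

(** If all seeds gave a smaller potential, summing over them would contradict the pointwise
    inequality. One seed thus serves all points at once. *)
Lemma exists_potential_le N (S : finType) (s0 : S) (h : X -> int) (k : S -> X -> int) :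
    bounded_amap h -> (forall s, bounded_amap (k s)) ->
    (forall x, \sum_(s : S) h x <= \sum_s k s x) ->
  exists s, potential N h <= potential N (k s).
Proof.
move=> bh bk hk; apply: contrapT => nex.
have lt s : potential N (k s) < potential N h.
  by rewrite ltNge; apply/negP => le; apply: nex; exists s.
have : \sum_(s : S) potential N h <= \sum_s potential N (k s).
  rewrite -!potential_sum //; apply: potential_mono => //; exact: bounded_amap_sum.
apply/negP; rewrite -ltNge (bigD1 s0) //= [X in _ < X](bigD1 s0) //= ltr_leD //.
by apply: ler_sum => s _; apply: ltW.
Qed.

End Potential.
End Mean.

(** * The sequence of stages and its limit *)

Section Matching.
Variables (R : realType) (X : ptopologicalType) (mu : probability (borel X) R).
Variables (G : set (X * X)) (T : set (set X)) (d : nat) (nb : X -> seq X) (lt : rel X)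
  (c : X -> bool).
Hypotheses (cX : has_cells X) (simpleG : simple_graph G) (borelG : borel_set G)
  (toastT : connected_toast G T) (d_gt0 : (0 < d)%N)
  (nb_uniq : forall x, uniq (nb x)) (size_nb : forall x, size (nb x) = d)
  (mem_nb : forall x y, (y \in nb x) = adj G x y)
  (lt_irr : irreflexive lt) (lt_trans : transitive lt)
  (lt_total : forall x y, x != y -> lt x y || lt y x)
  (amap_lt : amap (fun p : X * X => lt p.1 p.2))
  (colour : forall x y, G (x, y) -> c x != c y).

Local Notation invariant := (invariant G T d nb lt).
Local Notation energy := (energy nb).
Local Notation potential := (potential mu d nb).
Local Notation fractional_value v := (0 < v < d%:Z).

Lemma energy_bounded k f : invariant k f ->
  bounded_amap (energy f) /\ forall x, energy f x <= (d * (d * d))%N%:Z.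
Proof.
move=> invf; apply: (nsum_bounded cX nb_uniq size_nb mem_nb borelG) => // [|x y].
  exact: (amap_comp (fun v : int => v ^+ 2) (inv_amap invf)).
have /andP[f0 fd] := inv_itv invf x y; rewrite sqr_ge0 /= PoszM.
by rewrite expr2 ler_pM.
Qed.

(* [b x = 1] where averaging over the seeds of stage [k] raises the energy at
   [x] by at least 1/2. *)
Lemma stage N k f : invariant k f -> exists f' (b : X -> int),
  [/\ invariant k.+1 f', forall x y, f x y = 0 \/ f x y = d%:Z -> f' x y = f x y,
      bounded_amap b,
      forall (w : 'I_k -> X) L x y, enumerates T lt w -> T L -> L `<` range w ->
        L x -> L y -> fractional_value (f x y) -> b x != 0 &
      2 * potential N (energy f) + potential N b <= 2 * potential N (energy f')].
Proof.
move=> invf; pose u (sd : seed k) := update T d lt f sd.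
have invu sd : invariant k.+1 (u sd)
  by exact: (update_invariant toastT nb_uniq size_nb mem_nb lt_irr lt_trans lt_total
    cX borelG amap_lt).
have be := (energy_bounded invf).1; have beu sd := (energy_bounded (invu sd)).1.
pose g := gain T d nb lt k f.
have ag : amap g.
  apply: amap_sum => sd; have [ae _ _] := be; have [aeu _ _] := beu sd.
  exact: (amap_comp2 (fun v v' : int => v - v') aeu ae).
pose b x : int := if #|{: seed k}|%:Z <= 2 * g x then 1 else 0.
have bb : bounded_amap b.
  split.
  - exact: (amap_comp (fun v : int => if #|{: seed k}|%:Z <= 2 * v then 1 else 0 : int) ag).
  - by move=> x; rewrite /b; case: ifP.
  - by exists 1%N => x; rewrite /b; case: ifP.
(* Energies are doubled because the guaranteed mean gain is 1/2 and the functions are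
   integer-valued. *)
have [|sd sdP] := exists_potential_le mu cX nb_uniq size_nb mem_nb borelG N ([ffun=> true], true)
    (k := fun (sd : seed k) x => energy (u sd) x + energy (u sd) x)
    (bounded_amapD (bounded_amapD be be) bb) (fun sd => bounded_amapD (beu sd) (beu sd)).
  move=> x; rewrite -subr_ge0 -sumrB.
  have -> : \sum_sd (energy (u sd) x + energy (u sd) x - (energy f x + energy f x + b x)) =
      2 * g x - #|{: seed k}|%:Z * b x.
    rewrite (eq_bigr (fun sd => 2 * (energy (u sd) x - energy f x) - b x)).
      rewrite big_split /= -mulr_sumr sumr_const mulNrn; congr (_ - _).
      by rewrite -mulr_natl natz; congr (Posz _ * _); apply: eq_card.
    by move=> sd _; ring.
  have g0 : 0 <= g x by exact: (gain_ge0 toastT nb_uniq mem_nb lt_irr lt_trans invf).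
  by rewrite /b subr_ge0; case: ifP => [h|_]; [rewrite mulr1|rewrite mulr0 mulr_ge0].
exists (u sd), b; split=> //.
- by move=> x y; exact: (update_integral toastT lt_irr lt_trans).
- move=> w L x y ew TL Lw Lx Ly fxy; rewrite /b ifT //.
  exact: (gain_half simpleG toastT nb_uniq mem_nb lt_irr lt_trans invf colour ew TL Lw Lx Ly fxy).
- have pD := potentialD mu cX nb_uniq size_nb mem_nb borelG N.
  move: sdP; rewrite !pD //; last exact: bounded_amapD.
  by lra.
Qed.

(** Stage [k] is chosen for the potential truncated at [k + 1], which sees walks of length [n] once
    [n <= k]. Telescoping bounds the charges [b] by twice the last potential, at most [4 * d ^ 3];
    dividing by the weight of length [n] gives the constant. *)
Lemma matching_sequence : exists (f : nat -> X -> X -> int) (b : nat -> X -> int),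
  [/\ forall k, invariant k (f k),
      forall k x y, f k x y = 0 \/ f k x y = d%:Z -> f k.+1 x y = f k x y,
      forall k, bounded_amap (b k),
      forall k (w : 'I_k -> X) L x y, enumerates T lt w -> T L -> L `<` range w ->
        L x -> L y -> fractional_value (f k x y) -> b k x != 0 &
      forall n j, (n <= j)%N ->
        \sum_(n <= k < j) mean mu (walk_sum nb n (b k)) <= (2 * d%:R) ^+ n * (4 * (d * (d * d))%:R)].
Proof.
have /choice[S SP] (p : nat * (X -> X -> int)) : exists q : (X -> X -> int) * (X -> int),
    invariant p.1 p.2 ->
  [/\ invariant p.1.+1 q.1,
      forall x y, p.2 x y = 0 \/ p.2 x y = d%:Z -> q.1 x y = p.2 x y,
      bounded_amap q.2,
      forall (w : 'I_p.1 -> X) L x y, enumerates T lt w -> T L -> L `<` range w ->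
        L x -> L y -> fractional_value (p.2 x y) -> q.2 x != 0 &
      2 * potential p.1.+1 (energy p.2) + potential p.1.+1 q.2 <=
        2 * potential p.1.+1 (energy q.1)].
  have [invp|ninv] := pselect (invariant p.1 p.2); last by exists (p.2, fun=> 0).
  by have [f' [b fb]] := stage p.1.+1 invp; exists (f', b).
pose f := fix f k := if k is j.+1 then (S (j, f j)).1 else initial G d lt.
have invf k : invariant k (f k).
  elim: k => [|k IHk]; first exact: (initial_invariant T simpleG nb_uniq size_nb mem_nb
    lt_irr lt_trans lt_total cX borelG amap_lt colour d_gt0).
  by have [] := SP (k, f k) IHk.
exists f, (fun k => (S (k, f k)).2).
have bb k : bounded_amap (S (k, f k)).2 by have [] := SP (k, f k) (invf k).
have be k := (energy_bounded (invf k)).1.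
split=> // [k x y|k w L x y|n j nj].
- by have [_ + _ _ _] := SP (k, f k) (invf k); apply.
- by have [_ _ _ + _] := SP (k, f k) (invf k); apply.
(* Lowering the first truncation from [k + 1] to [k] only weakens the inequality and lets
   consecutive stages telescope. *)
have step k : 2 * potential k (energy (f k)) + potential k.+1 (S (k, f k)).2 <=
    2 * potential k.+1 (energy (f k.+1)).
  have [_ _ _ _] := SP (k, f k) (invf k); apply: le_trans; rewrite lerD2r ler_pM2l //.
  exact: (potentialS mu cX nb_uniq size_nb mem_nb borelG).
have w_gt0 : 0 < (2 * d%:R : R) ^+ n by rewrite exprn_gt0 // mulr_gt0 // ltr0n.
rewrite -ler_pdivrMl //.
have : \sum_(n <= k < j) potential k.+1 (S (k, f k)).2 <= 2 * potential j (energy (f j)).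
  elim: j nj => [|j IHj]; rewrite ?leqn0.
    move=> /eqP ->; rewrite big_geq // mulr_ge0 //.
    exact: (potential_ge0 mu cX nb_uniq size_nb mem_nb borelG).
  rewrite leq_eqVlt => /orP[/eqP <-|]; first by rewrite big_geq // mulr_ge0 //;
    exact: (potential_ge0 mu cX nb_uniq size_nb mem_nb borelG).
  rewrite ltnS => nj; rewrite big_nat_recr //=; apply: le_trans (step j).
  by rewrite lerD2r IHj.
move=> sum_le; apply: le_trans (le_trans sum_le _); last first.
  have := potential_le mu cX nb_uniq size_nb mem_nb borelG d_gt0 j (be j) (energy_bounded (invf j)).2.
  by lra.
rewrite mulr_sumr; apply: ler_sum_nat => k /andP[nk _].
exact: (potential_term mu cX nb_uniq size_nb mem_nb borelG).
Qed.

Theorem matching_on_conull : exists X' : set X,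
  [/\ borel_set X', graph_invariant G X', mu (~` X') = 0%E &
      exists M : set (X * X), borel_perfect_matching G X' M].
Proof.
have [f [b [invf stab bb bP bsum]]] := matching_sequence.
have stable k j x y : (k <= j)%N -> f k x y = 0 \/ f k x y = d%:Z -> f j x y = f k x y.
  move=> /subnK <- fk; elim: (j - k)%N => // i IHi.
  by rewrite addSn stab // IHi.
(* Written as a neighbour sum so that [amap_nsum] applies. *)
pose bad k x := nsum nb (fun y => (fractional_value (f k x y) : nat)%:Z) x.
have badP k x : bad k x = 0 <-> forall y, G (x, y) -> f k x y = 0 \/ f k x y = d%:Z.
  split=> [b0 y Gy|fy].
    have : (fractional_value (f k x y) : nat)%:Z = 0.
      have := b0; rewrite /bad /nsum => /eqP; rewrite psumr_eq0 // => /allP/(_ y).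
      by rewrite mem_nb => /(_ (introT (adjP _ _ _) Gy))/eqP.
    by have := inv_itv (invf k) x y; lia.
  rewrite /bad /nsum big1_seq // => y /andP[_]; rewrite mem_nb => /adjP/fy.
  by move=> [->|->]; rewrite ltxx ?andbF.
pose X0 := [set x | exists k, bad k x = 0].
have abad k : amap (bad k).
  apply: (amap_nsum nb_uniq size_nb mem_nb cX borelG
    (h := fun x y => (fractional_value (f k x y) : nat)%:Z)).
  exact: (amap_comp (fun v : int => (fractional_value v : nat)%:Z) (inv_amap (invf k))).
have bX0 : borel_set X0.
  rewrite (_ : X0 = \bigcup_k [set x | bad k x = 0]); last first.
    by apply/seteqP; split=> x; [move=> [k]; exists k|move=> [k _]; exists k].
  by apply: borel_bigcup => k; exact: (amap_borel cX (fun v : int => v = 0) (abad k)).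
pose out x : int := (~~ `[< X0 x >] : nat)%:Z.
have bout : bounded_amap out.
  split.
  - exact: (amap_comp (fun v : bool => (~~ v : nat)%:Z) (borel_amap cX bX0)).
  - by [].
  - by exists 1%N => x; rewrite /out; case: asboolP.
have outP x : out x != 0 <-> ~ X0 x by rewrite /out; case: asboolP.
(* Keeping whole components gives invariance; [X'E] rewrites this by walk sums, which gives
   Borelness. *)
pose X' := [set x | component G x `<=` X0].
have X'E : X' = \bigcap_n [set x | walk_sum nb n out x = 0].
  apply/seteqP; split=> [x xX0 n _|x xn y [p xp <-]].
    apply/eqP; apply: contrapT => /negP/(walk_sum_neq0 mem_nb)[p [xp /outP]]; apply.
    by apply: xX0; exists p.
  apply: contrapT => /outP hy.
  have out0 z : 0 <= out z by [].
  have /eqP := walk_sum_path mem_nb out0 xp erefl hy.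
  by apply; apply: xn.
have bX' : borel_set X'.
  rewrite X'E; apply: borel_bigcap => n.
  have [an _ _] := bounded_walk_sum cX nb_uniq size_nb mem_nb borelG n bout.
  exact: (amap_borel cX (fun v : int => v = 0) an).
have X'comp x y : X' x -> G (x, y) -> X' y.
  by move=> xX' xy; rewrite /X' /= -(component_eq simpleG (reachable_edge xy)).
have X'X0 x : X' x -> X0 x by apply; exact: reachable_refl.
exists X'; split => //.
- exists X'; apply/seteqP; split=> [x xX'|y [x xX' xy]].
    by exists x => //; exact: reachable_refl.
  by rewrite /X' /= -(component_eq simpleG xy).
(* Stages before [n] are dropped because [bsum] controls walks of length [n] only from stage [n]
   on. *)
- pose E n j : set (borel X) := [set x | (n <= j)%N && (walk_sum nb n (b j) x != 0)].
  have bw n j := bounded_walk_sum cX nb_uniq size_nb mem_nb borelG n (bb j).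
  have mE n j : measurable (E n j).
    have [an _ _] := bw n j.
    exact: (amap_borel cX (fun v : int => (n <= j)%N && (v != 0)) an).
  have E0 n : mu (lim_sup_set (E n)) = 0%E.
    apply: lim_sup_set_cvg0 => //.
    apply: (@le_lt_trans _ _ ((2 * d%:R) ^+ n * (4 * (d * (d * d))%:R))%:E); last exact: ltry.
    apply: lime_le; first exact: is_cvg_nneseries.
    apply: nearW => j /=; have [nj|jn] := leqP n j; last first.
      rewrite big_nat big1 => [|k /andP[_ kj]].
        by rewrite lee_fin mulr_ge0 // exprn_ge0 // mulr_ge0.
      rewrite (_ : E n k = set0) ?measure0 //; apply/seteqP; split=> // x /andP[nk].
      by have := leq_trans (leq_trans kj (ltnW jn)) nk; rewrite ltnn.
    rewrite (big_cat_nat _ nj) //= big_nat big1 ?add0e => [|k /andP[_ kn]]; last first.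
      rewrite (_ : E n k = set0) ?measure0 //; apply/seteqP; split=> // x /andP[nk].
      by move: nk; rewrite leqNgt kn.
    apply: le_trans (_ : (\sum_(n <= k < j) (mean mu (walk_sum nb n (b k)))%:E <= _)%E).
      rewrite big_nat [leRHS]big_nat; apply: lee_sum => k /andP[nk _].
      apply: le_trans (measure_support_le mu cX (bw n k)).
      by apply: le_measure; rewrite ?inE //;
        [exact: (amap_borel cX (fun v : int => v != 0) (let: And3 h _ _ := bw n k in h))|move=> x /andP[]].
    by rewrite sumEFin lee_fin; apply: bsum.
  (* A walk leads from [x] to some [y] with an edge that never becomes integral; otherwise its
     finitely many neighbours would be settled at a common stage. The component of [y] is infinite,
     so arbitrarily large pieces strictly contain a toast set with that edge, and each of their
     stages charges [y]. *)
  have sub : ~` X' `<=` \bigcup_n lim_sup_set (E n).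
    move=> x /existsNP[y /not_implyP[[p xp py] nX0]]; exists (size p) => // m _.
    have /existsNP[z /not_implyP[yz fz]] : ~ forall z, G (y, z) -> exists k, f k y z = 0 \/ f k y z = d%:Z.
      move=> h; apply: nX0.
      have [k kP] : exists k, forall z, z \in nb y -> f k y z = 0 \/ f k y z = d%:Z.
        have : forall z, z \in nb y -> G (y, z) by move=> z; rewrite mem_nb => /adjP.
        elim: (nb y) => [_|z s IHs hs]; first by exists 0%N.
        have [|k kP] := IHs; first by move=> u us; apply: hs; rewrite inE us orbT.
        have [j jP] := h z (hs z (mem_head _ _)).
        exists (maxn k j) => u; rewrite inE => /orP[/eqP ->|us].
          by rewrite (stable _ _ _ _ (leq_maxr k j) jP).
        by have fu := kP u us; rewrite (stable _ _ _ _ (leq_maxl k j) fu).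
      by exists k; apply/badP => z yz; apply: kP; rewrite mem_nb; apply/adjP.
    have frac k : fractional_value (f k y z).
      have := inv_itv (invf k) y z; have : ~ (f k y z = 0 \/ f k y z = d%:Z).
        by move=> h; apply: fz; exists k.
      by lia.
    have nfy : ~ fin_comp G y.
      by move=> fy; have := inv_fin (invf 0%N) z fy; have := frac 0%N; lia.
    have [L [TL Ly Lz]] := toast_edge toastT yz.
    have [k [w [ew mk Lw]]] := toast_unbounded toastT lt_irr lt_trans lt_total (maxn m (size p)) nfy TL Ly.
    exists k => /=; first by apply: ltnW; apply: leq_ltn_trans mk; exact: leq_maxl.
    apply/andP; split; first by apply: ltnW; apply: leq_ltn_trans mk; exact: leq_maxr.
    apply: (walk_sum_path mem_nb _ xp) => //; first by have [_ b0 _] := bb k.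
    by rewrite py; apply: bP ew TL Lw Ly Lz (frac k).
  have [n|B [mB B0 sB]] := @negligible_bigcup _ _ _ mu (fun n => lim_sup_set (E n)).
    exists (lim_sup_set (E n)); split; [|exact: E0|by []].
    by apply: bigcap_measurable => // m _; apply: bigcup_measurable.
  have mC : measurable (~` X' : set (borel X)) := borel_setC bX'.
  apply/eqP; rewrite -measure_le0 -B0.
  by apply: le_measure; rewrite ?inE //; exact: subset_trans sub sB.
pose M := [set p : X * X | X' p.1 /\ exists k, f k p.1 p.2 = d%:Z].
have d0 : (d%:Z : int) <> 0 by lia.
exists M; split.
- rewrite (_ : M = \bigcup_k [set p | `[< X' p.1 >] && (f k p.1 p.2 == d%:Z)]); last first.
    apply/seteqP; split=> [[x y] [/= xX' [k fk]]|[x y] [k _ /= /andP[/asboolP xX' /eqP fk]]].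
      by exists k => //=; rewrite fk eqxx andbT; apply/asboolP.
    by split=> //; exists k.
  apply: borel_bigcup => k.
  have fstC : continuous (fst : X * X -> X) by move=> p; apply: cvg_fst.
  have aX' := amap_subst fstC (borel_amap cX bX').
  exact: (amap_borel (prod_has_cells cX cX) (fun v : bool * int => v.1 && (v.2 == d%:Z))
    (amap_pair aX' (inv_amap (invf k)))).
- move=> [x y] [/= xX' [k fk]]; have xy : G (x, y).
    by apply: (inv_supp (invf k)); rewrite fk; apply/eqP.
  by split=> //; split=> //=; apply: X'comp xy.
- move=> x y [/= xX' [k fk]]; have xy : G (x, y).
    by apply: (inv_supp (invf k)); rewrite fk; apply/eqP.
  by split=> /=; [exact: X'comp xy|exists k; rewrite (inv_sym (invf k))].
move=> x xX'; have [k /badP fx] := X'X0 x xX'.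
have val y : y \in nb x -> f k x y = 0 \/ f k x y = d%:Z.
  by rewrite mem_nb => /adjP/fx.
have sum_d := inv_sum (invf k) x; rewrite /nsum in sum_d.
have [y yx fy] : exists2 y, y \in nb x & f k x y = d%:Z.
  apply: contrapT => ny; move: sum_d; rewrite big1_seq => [e|y /andP[_ yx]]; first by lia.
  by have [//|fy] := val y yx; case: ny; exists y.
exists y; split; first by split=> //; exists k.
move=> z [/= _ [j fz]].
(* Both stages are compared at the later one: integral values never change. *)
have fkz : f k x z = d%:Z.
  have Gz : G (x, z) by apply: (inv_supp (invf j)); rewrite fz; apply/eqP.
  rewrite -(stable k (maxn k j)) ?leq_maxl //; last exact: fx.
  by rewrite (stable j) ?leq_maxr //; right.
have zx : z \in nb x.
  by rewrite mem_nb; apply/adjP; apply: (inv_supp (invf k)); rewrite fkz; apply/eqP.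
(* Two neighbours of value [d] would push the sum above [d]. *)
apply: contrapT => yz; move: sum_d; rewrite (big_rem y) //= (big_rem z) /=; last first.
  by rewrite mem_rem_uniq // inE zx andbT; apply/eqP => zy; apply: yz.
rewrite fy fkz.
have : 0 <= \sum_(u <- rem z (rem y (nb x))) f k x u.
  by apply: sumr_ge0 => u _; have /andP[] := inv_itv (invf k) x u.
move=> s0 /eqP; rewrite -[X in _ == X]addr0 (inj_eq (addrI _)) gt_eqF //.
by rewrite ltr_wpDr // ltz_nat.
Qed.

End Matching.

End Energies.

Local Open Scope classical_set_scope.

Theorem theorem4p7 (R : realType) (X : ptopologicalType) (hX : polish R X)
    (mu : probability (borel X) R) (d : nat) (hd : (1 <= d)%N)
    (G : set (X * X)) (hG : borel_graph G) (hreg : regular d G)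
    (hbip : bipartite G) (htoast : exists T : set (set X), connected_toast G T) :
  exists X' : set X,
    [/\ borel_set X', graph_invariant G X', mu (~` X') = 0%E &
        exists M : set (X * X), borel_perfect_matching G X' M].
Proof.
have [simpleG borelG] := hG; have [T toastT] := htoast.
have cX : has_cells X := polish_has_cells (inhabits point) hX.
have [nb [nb_uniq size_nb mem_nb]] := neighbours_exist hreg.
have [lt [lt_irr lt_trans lt_total amap_lt]] := borel_linear_order cX.
have [c colour] := bipartite_colouring simpleG hbip.
exact: (matching_on_conull mu cX simpleG borelG toastT hd nb_uniq size_nb mem_nb
  lt_irr lt_trans lt_total amap_lt colour).
Qed.
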